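(* Assume $\frac{\alpha}{\mathsf p}+\frac{\gamma}{\mathsf q}=1$ and $\frac{\beta}{\mathsf p}+\frac{\delta}{\mathsf q}=1$, set $\rho_0=\alpha/\mathsf p$, $\rho_\ell=\delta/\mathsf q$, let $n\ge1$ and fix an initial state $(\eta,N)\in\{0,1\}^{\{1,\dots,\ell-1\}}\times\mathbb Z_{\ge0}$. There exists a unique function $u:\mathbb R_+\times\mathbb W^n_{[1,\ell]}\to\mathbb R$ which satisfies: (1) for all $\vec x\in\mathbb W^n_{[1,\ell]}$ and $t\in\mathbb R_+$, $\frac{d}{dt}u(t;\vec x)=\mathscr D^{(n,\rho_0,\rho_\ell)}u(t;\vec x)$; (2) for any $\vec x\in\mathbb W^n_{[1,\ell]}$, $u(0;\vec x)=H(\eta,N;\vec x)$. This solution is such that for all $\vec x\in\mathbb W^n_{[1,\ell]}$ and $t\in\mathbb R_+$, $u(t;\vec x)=\mathbb E^{\eta,N}[H(\eta(t),N_\ell(t);\vec x)]$, where $\mathbb E^{\eta,N}$ denotes expectation with respect to open ASEP on the segment started from $(\eta,N)$.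
   Context: Parameters: an integer $\ell\ge2$, real numbers $\mathsf p>\mathsf q>0$ and $\alpha,\beta,\gamma,\delta\ge0$; $q:=\mathsf q/\mathsf p\in(0,1)$. Open ASEP on a segment: the Markov process $(\eta(t),N_\ell(t))$ with $\eta(t)\in\{0,1\}^{\{1,\dots,\ell-1\}}$, $N_\ell(t)\in\mathbb Z$, with the following independent transitions: for $1\le x\le\ell-2$ a particle jumps from $x$ to $x+1$ at rate $\mathsf p\,\eta_x(1-\eta_{x+1})$ and from $x+1$ to $x$ at rate $\mathsf q\,\eta_{x+1}(1-\eta_x)$; a particle is created (resp. annihilated) at site $1$ at rate $\alpha(1-\eta_1)$ (resp. $\gamma\eta_1$); a particle is created at site $\ell-1$ at rate $\delta(1-\eta_{\ell-1})$, in which case $N_\ell$ decreases by $1$, and annihilated at site $\ell-1$ at rate $\beta\eta_{\ell-1}$, in which case $N_\ell$ increases by $1$. For $1\le x\le\ell$: $N_x(\eta,N_\ell)=\sum_{i=x}^{\ell-1}\eta_i+N_\ell$, $Q_x(\eta,N_\ell)=q^{N_x(\eta,N_\ell)}$, and $H(\eta,N_\ell;\vec x)=\prod_{i=1}^nQ_{x_i}(\eta,N_\ell)$. $\mathbb W^n_{[1,\ell]}=\{\vec x\in\mathbb Z^n:1\le x_1<\dots<x_n\le\ell\}$, $\vec x_i^\pm=(x_1,\dots,x_i\pm1,\dots,x_n)$. For $f:\mathbb W^n_{[1,\ell]}\to\mathbb R$, $$\begin{aligned}\mathscr D^{(n,\rho_0,\rho_\ell)}f(\vec x)={}&\sum_{\substack{2\le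 i\le n\\ x_i-x_{i-1}>1}}\mathsf p\big(f(\vec x_i^-)-f(\vec x)\big)+\sum_{\substack{1\le i\le n-1\\ x_{i+1}-x_i>1}}\mathsf q\big(f(\vec x_i^+)-f(\vec x)\big)\\ &+\mathbf 1_{x_1>1}\mathsf p\big(f(\vec x_1^-)-f(\vec x)\big)-\mathbf 1_{x_1=1}(\mathsf p-\mathsf q)\rho_0f(\vec x)\\ &+\mathbf 1_{x_n<\ell}\,\mathsf q\big(f(\vec x_n^+)-f(\vec x)\big)+\mathbf 1_{x_n=\ell}(\mathsf p-\mathsf q)\rho_\ell f(\vec x).\end{aligned}$$ *)

(* Defs.v *)
From HB Require Import structures.
From mathcomp Require Import all_boot all_order all_algebra all_fingroup.
From mathcomp Require Import all_classical all_reals all_analysis.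

Set Implicit Arguments.
Unset Strict Implicit.
Unset Printing Implicit Defensive.

Import Order.TTheory GRing.Theory Num.Theory.
Import numFieldNormedType.Exports.
Local Open Scope classical_set_scope.
Local Open Scope ring_scope.

(* Sites are numbered 1, ..., l - 1; site k is the ordinal of value k - 1. *)
Definition config (l : nat) := {ffun 'I_l.-1 -> bool}.

Definition state (l : nat) := (config l * int)%type.

Definition swap_sites (l : nat) (eta : config l) (x y : 'I_l.-1) : config l :=
  [ffun z => eta (tperm x y z)].

Definition flip_site (l : nat) (eta : config l) (x : 'I_l.-1) : config l :=
  [ffun z => if z == x then ~~ eta z else eta z].

(* Each transition of rate r from s to s' contributes r * (f s' - f s).  When
   l = 2 the sites 1 and l - 1 coincide and both boundary mechanisms act
   there.  The value on the indicator function of a state s' <> s is the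
   transition rate from s to s'. *)
Definition open_asep_generator (R : realType) (l : nat)
    (p q alpha beta gamma delta : R) (f : state l -> R) (s : state l) : R :=
  let eta := s.1 in let N := s.2 in
  \sum_(x : 'I_l.-1) \sum_(y : 'I_l.-1 | y == x.+1 :> nat)
     (p * ((eta x)%:R * (1 - (eta y)%:R)) + q * ((eta y)%:R * (1 - (eta x)%:R)))
     * (f (swap_sites eta x y, N) - f s)
  + \sum_(x : 'I_l.-1 | x == 0%N :> nat)
     (alpha * (1 - (eta x)%:R) + gamma * (eta x)%:R)
     * (f (flip_site eta x, N) - f s)
  + \sum_(x : 'I_l.-1 | x.+1 == l.-1 :> nat)
     (delta * (1 - (eta x)%:R) * (f (flip_site eta x, N - 1) - f s)
      + beta * (eta x)%:R * (f (flip_site eta x, N + 1) - f s)).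

(* Transition function of a time-homogeneous Markov chain on a discrete state
   space S, whose matrix of rates is given by the generator L applied to
   indicator functions: off the diagonal the rates, on the diagonal minus the
   total exit rate. *)
Record is_transition_function (R : realType) (S : choiceType)
    (L : (S -> R) -> S -> R) (pt : R -> S -> S -> R) : Prop := {
  transition_ge0 : forall t s s', 0 <= t -> 0 <= pt t s s' ;
  transition_sum1 : forall t s, 0 <= t ->
    \esum_(s' in setT) (pt t s s')%:E = 1%:E ;
  transition_init : forall s s', pt 0 s s' = (s == s')%:R ;
  transition_semigroup : forall t h s s', 0 <= t -> 0 <= h ->
    (pt (t + h) s s')%:E = \esum_(z in setT) (pt t s z * pt h z s')%:E ;
  transition_rates : forall s s',
    (pt h s s' - pt 0 s s') / h @[h --> 0^'+] -->
      L (fun z => (z == s')%:R) s }.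

(* Continuous-time Markov jump process (X t) for t >= 0 with generator L,
   started from s0.  S carries the discrete sigma-algebra and topology. *)
Record is_markov_jump_process (R : realType) (S : choiceType)
    (L : (S -> R) -> S -> R) (s0 : S)
    (d : measure_display) (Omega : measurableType d) (P : probability Omega R)
    (X : R -> Omega -> S) : Prop := {
  process_measurable : forall t s, 0 <= t -> measurable (X t @^-1` [set s]) ;
  process_right_continuous : forall w t, 0 <= t ->
    \forall h \near 0^'+, X (t + h) w = X t w ;
  process_left_limits : forall w t, 0 < t ->
    exists s, \forall h \near 0^'+, X (t - h) w = s ;
  process_init : P (X 0 @^-1` [set s0]) = 1%:E ;
  process_markov : exists2 pt, is_transition_function L pt &
    forall (past : seq (R * S)) (t h : R) (s s' : S),
      0 <= t -> 0 <= h ->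
      (forall c, c \in past -> 0 <= c.1 <= t) ->
      let A := [set w | forall c, c \in past -> X c.1 w = c.2] in
      P (A `&` X t @^-1` [set s] `&` X (t + h) @^-1` [set s']) =
      (P (A `&` X t @^-1` [set s]) * (pt h s s')%:E)%E }.

Definition is_open_asep (R : realType) (l : nat)
    (p q alpha beta gamma delta : R) (s0 : state l)
    (d : measure_display) (Omega : measurableType d) (P : probability Omega R)
    (X : R -> Omega -> state l) : Prop :=
  is_markov_jump_process (open_asep_generator p q alpha beta gamma delta)
    s0 P X.

Definition Nheight (l : nat) (s : state l) (x : int) : int :=
  \sum_(i : 'I_l.-1 | x <= i.+1%:Z) (s.1 i : nat)%:Z + s.2.

(* q is the asymmetry ratio in (0, 1), not the left jump rate. *)
Definition Qheight (R : realType) (q : R) (l : nat) (s : state l) (x : int) :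
  R := q ^ Nheight s x.

Definition Hdual (R : realType) (q : R) (l n : nat) (s : state l)
    (x : {ffun 'I_n -> int}) : R :=
  \prod_(i < n) Qheight q s (x i).

Definition weyl (n l : nat) : set {ffun 'I_n -> int} :=
  [set x | (forall i, 1 <= x i <= l%:Z) /\
           (forall i j : 'I_n, (i < j)%N -> x i < x j)].
Arguments weyl : clear implicits.

Definition shift_coord (n : nat) (x : {ffun 'I_n -> int}) (i : 'I_n) (a : int) :
  {ffun 'I_n -> int} := [ffun j => if j == i then x j + a else x j].

(* Functions on the chamber weyl n l are represented by functions on Z^n: at a
   point of the chamber, only values at points of the chamber contribute.  The
   coordinates x_1 and x_n are those of index 0 and n - 1. *)
Definition Dop (R : realType) (n l : nat) (p q rho0 rhol : R)
    (f : {ffun 'I_n -> int} -> R) (x : {ffun 'I_n -> int}) : R :=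
  \sum_(i < n) \sum_(j < n | (i == j.+1 :> nat) && (1 < x i - x j))
     p * (f (shift_coord x i (-1)) - f x)
  + \sum_(i < n) \sum_(j < n | (j == i.+1 :> nat) && (1 < x j - x i))
     q * (f (shift_coord x i 1) - f x)
  + \sum_(i < n | i == 0%N :> nat)
     ((1 < x i)%R%:R * (p * (f (shift_coord x i (-1)) - f x))
      - (x i == 1)%R%:R * ((p - q) * rho0 * f x))
  + \sum_(i < n | i.+1 == n :> nat)
     ((x i < l%:Z)%R%:R * (q * (f (shift_coord x i 1) - f x))
      + (x i == l%:Z)%R%:R * ((p - q) * rhol * f x)).

(* Derivative at t of a function on [0, +oo[, one-sided at t = 0. *)
Definition has_derivative_Rplus (R : realType) (g : R -> R) (t a : R) : Prop :=
  (g r - g t) / (r - t) @[r --> within [set r : R | 0 <= r] t^'] --> a.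

Definition solves_dual_system (R : realType) (n l : nat) (p q rho0 rhol : R)
    (s0 : state l) (u : R -> {ffun 'I_n -> int} -> R) : Prop :=
  (forall x t, weyl n l x -> 0 <= t ->
     has_derivative_Rplus (fun r => u r x) t (Dop l p q rho0 rhol (u t) x)) /\
  (forall x, weyl n l x -> u 0 x = Hdual (q / p) s0 x).

(* Main.v *)
From HB Require Import structures.
Require Import Defs.
From mathcomp Require Import all_boot all_order all_algebra all_fingroup.
From mathcomp Require Import all_classical all_reals all_analysis.
From mathcomp Require Import measurable_realfun.
From mathcomp Require Import ring lra zify.

Set Implicit Arguments.
Unset Strict Implicit.
Unset Printing Implicit Defensive.

Import Order.TTheory GRing.Theory Num.Theory.
Import numFieldNormedType.Exports.
Local Open Scope classical_set_scope.
Local Open Scope ring_scope.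

(* With the reservoir densities rho0 and rhol as occupation variables at sites
   0 and l, the generator L of the process acting on H(.; x) and the operator D
   acting on H(s; .) both multiply H(s; x) by
   (p - q) sum_i (eta_(x_i) - eta_(x_i - 1)), so L H = D H (duality).  Hence
   u = exp(t D) H = exp(t L) H, both given by the same power series: u solves
   the dual system in x and the backward equation in the state.  For the
   expectation, truncate H where N < - M: by the semigroup property the
   expectation of the bounded truncation solves the backward equation too, and
   a Gronwall estimate with a weight growing faster than H as N tends to -oo
   bounds its distance to u by O((q/p)^M).  The same estimate with weight 1
   gives uniqueness. *)

(** * Finitary linear operators and their exponentials *)

(** The obstacle is that [H] is unbounded as N tends to -oo, while the law of the process is known
    only through some transition function whose rates are right derivatives at time 0. The
    expectation of [H] is therefore neither obviously finite nor directly differentiable. In the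
    norm sup |f| / W, with W = 1 + (q/p)^((n+1) N), the generator is nevertheless bounded: a
    transition moves N by at most 1, hence multiplies W by at most a constant. This is why exp(t L)
    can be a plain power series. The extra power of (q/p)^N, compared with the largest value of [H],
    produces the rate (q/p)^M of the truncation error. The truncated function is bounded only by
    (q/p)^(-M n), which blows up with M. So the Gronwall estimate must give a conclusion free of its
    a priori bound, and depend only on the error at time 0. Every row of [L] and of [D] is a finite
    sum, so exchanging the two operators, or one of them with a limit, is an exchange of finite
    sums. *)

Definition finitary (R : realType) (S : choiceType) (D : set S) (W : S -> R)
    (B : R) (phi : (S -> R) -> R) : Prop :=
  exists r : seq (R * S),
    [/\ forall c, c \in r -> D c.2,
        \sum_(c <- r) `|c.1| * W c.2 <= B &
        forall f, phi f = \sum_(c <- r) c.1 * f c.2].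

(** Boundedness of [A], with norm at most [C], for the norm sup |f| / W over [D], together with
    finiteness of its rows. For the dual operator [D] is the chamber, outside of which functions on
    Z^n carry arbitrary values. *)
Definition finitary_op (R : realType) (S : choiceType) (D : set S) (W : S -> R)
    (C : R) (A : (S -> R) -> S -> R) : Prop :=
  forall s, D s -> finitary D W (C * W s) (A^~ s).

Lemma cvg_bigsum (R : realType) (T I : Type) (F : set_system T) {FF : Filter F}
    (r : seq I) (P : pred I) (f : I -> T -> R) (a : I -> R) :
  (forall i, P i -> f i @ F --> a i) ->
  \sum_(i <- r | P i) f i t @[t --> F] --> \sum_(i <- r | P i) a i.
Proof.
move=> fa; elim: r => [|i r ih].
  by under eq_fun do rewrite big_nil; rewrite big_nil; exact: cvg_cst.
under eq_fun do rewrite big_cons; rewrite big_cons.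
by case: ifPn => // /fa ?; apply: cvgD.
Qed.

Section finitary.
Context {R : realType} {S : choiceType} (D : set S) (W : S -> R).
Implicit Types (B : R) (phi : (S -> R) -> R).

Lemma finitary_eval s : D s -> finitary D W (W s) (fun f => f s).
Proof.
move=> Ds; exists [:: (1, s)]; split => [c||f].
- by rewrite inE => /eqP ->.
- by rewrite big_seq1 normr1 mul1r.
- by rewrite big_seq1 mul1r.
Qed.

Lemma finitary_le B B' phi : B <= B' -> finitary D W B phi -> finitary D W B' phi.
Proof. by move=> BB' [r [rD rB rE]]; exists r; split => //; exact: le_trans BB'. Qed.

Lemma finitary0 : finitary D W 0 (fun=> 0).
Proof. by exists [::]; split => // [|f]; rewrite big_nil. Qed.

Lemma finitaryD B1 B2 phi1 phi2 : finitary D W B1 phi1 -> finitary D W B2 phi2 ->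
  finitary D W (B1 + B2) (fun f => phi1 f + phi2 f).
Proof.
move=> [r1 [D1 h1 e1]] [r2 [D2 h2 e2]]; exists (r1 ++ r2); split => [c||f].
- by rewrite mem_cat => /orP[/D1|/D2].
- by rewrite big_cat /= lerD.
- by rewrite big_cat /= e1 e2.
Qed.

Lemma finitaryZ a B phi : finitary D W B phi ->
  finitary D W (`|a| * B) (fun f => a * phi f).
Proof.
move=> [r [rD rB rE]]; exists [seq (a * c.1, c.2) | c <- r]; split => [c||f].
- by case/mapP => c' /rD ? ->.
- rewrite big_map; under eq_bigr do rewrite /= normrM -mulrA.
  by rewrite -mulr_sumr ler_wpM2l.
- by rewrite big_map rE mulr_sumr; apply: eq_bigr => c _; rewrite mulrA.
Qed.

Lemma finitaryB B1 B2 phi1 phi2 : finitary D W B1 phi1 -> finitary D W B2 phi2 ->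
  finitary D W (B1 + B2) (fun f => phi1 f - phi2 f).
Proof.
move=> h1 /(finitaryZ (-1)); rewrite normrN1 mul1r => h2.
have [r [? ? rE]] := finitaryD h1 h2; exists r; split => // f.
by rewrite -rE mulN1r.
Qed.

Lemma finitary_sum (I : Type) (s : seq I) (P : pred I) (B : I -> R)
    (phi : I -> (S -> R) -> R) :
  (forall i, P i -> finitary D W (B i) (phi i)) ->
  finitary D W (\sum_(i <- s | P i) B i) (fun f => \sum_(i <- s | P i) phi i f).
Proof.
move=> h; elim: s => [|i s ih].
  have [r [? ? rE]] := finitary0; exists r; split => // [|f]; first by rewrite big_nil.
  by rewrite -rE big_nil.
have [Pi|nPi] := boolP (P i).
  have [r [? ? rE]] := finitaryD (h _ Pi) ih; exists r; split => // [|f].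
    by rewrite big_cons Pi.
  by rewrite -rE big_cons Pi.
have [r [? ? rE]] := ih; exists r; split => // [|f].
  by rewrite big_cons (negbTE nPi).
by rewrite -rE big_cons (negbTE nPi).
Qed.

(** A jump excluded by its indicator may lead out of the chamber, so [phi] is controlled only under
    [b]. *)
Lemma finitary_if (b : bool) B phi : 0 <= B -> (b -> finitary D W B phi) ->
  finitary D W B (fun f => b%:R * phi f).
Proof.
case: b => B0 h; last first.
  have [r [? h2 rE]] := finitary0; exists r; split => // [|f].
    exact: le_trans h2 B0.
  by rewrite -rE mul0r.
have [r [? ? rE]] := h isT; exists r; split => // f.
by rewrite -rE mul1r.
Qed.

Lemma finitary_sub B phi f g : finitary D W B phi ->
  phi (fun s => f s - g s) = phi f - phi g.
Proof.
move=> [r [_ _ rE]]; rewrite !rE -sumrB; apply: eq_bigr => c _.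
by rewrite mulrBr.
Qed.

Lemma finitary_eq B phi f g : finitary D W B phi ->
  (forall s, D s -> f s = g s) -> phi f = phi g.
Proof.
move=> [r [rD _ rE]] fg; rewrite !rE big_seq [RHS]big_seq.
by apply: eq_bigr => c /rD/fg ->.
Qed.

Lemma finitary_bound B phi K f : 0 <= K -> finitary D W B phi ->
  (forall s, D s -> `|f s| <= K * W s) -> `|phi f| <= K * B.
Proof.
move=> K0 [r [rD rB rE]] fK; rewrite rE.
apply: le_trans (ler_norm_sum _ _ _) _.
apply: le_trans (ler_wpM2l K0 rB); rewrite mulr_sumr big_seq [leRHS]big_seq.
by apply: ler_sum => c /rD/fK ?; rewrite normrM mulrCA ler_wpM2l.
Qed.

Lemma finitary_cvg B phi (F : nat -> S -> R) (f : S -> R) : finitary D W B phi ->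
  (forall s, D s -> F ^~ s @ \oo --> f s) -> phi (F k) @[k --> \oo] --> phi f.
Proof.
move=> [r [rD _ rE]] Ff; rewrite rE big_seq.
have -> : (fun k => phi (F k)) = fun k => \sum_(c <- r | c \in r) c.1 * F k c.2.
  by apply/funext => k; rewrite rE -big_seq.
apply: cvg_bigsum => c /rD/Ff Fc; apply: cvgM Fc; exact: cvg_cst.
Qed.

Lemma finitary_psum B phi (a : nat -> S -> R) n : finitary D W B phi ->
  phi (fun s => \sum_(0 <= k < n) a k s) = \sum_(0 <= k < n) phi (a k).
Proof.
move=> [r [_ _ rE]]; rewrite rE.
under [RHS]eq_bigr do rewrite rE.
by rewrite exchange_big /=; apply: eq_bigr => c _; rewrite mulr_sumr.
Qed.

Lemma finitary_scale B phi a f : finitary D W B phi ->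
  phi (fun s => f s * a) = phi f * a.
Proof.
move=> [r [_ _ rE]]; rewrite !rE mulr_suml; apply: eq_bigr => c _.
by rewrite mulrA.
Qed.

End finitary.

(** Fubini for two finite sums. It lets an operator in the state commute with an operator in the
    dual variable. *)
Lemma finitary_comm (R : realType) (S T : choiceType) (D : set S) (W : S -> R)
    (E : set T) (V : T -> R) B C phi psi (f : S -> T -> R) :
  finitary D W B phi -> finitary E V C psi ->
  phi (fun s => psi (f s)) = psi (fun t => phi (f^~ t)).
Proof.
move=> [r [_ _ rE]] [q [_ _ qE]]; rewrite rE qE.
under eq_bigr do rewrite qE mulr_sumr.
under [RHS]eq_bigr do rewrite rE mulr_sumr.
by rewrite exchange_big /=; apply: eq_bigr => c _; apply: eq_bigr => d _; rewrite mulrCA.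
Qed.

Definition exp_op (R : realType) (S : Type) (A : (S -> R) -> S -> R) (f : S -> R)
    (t : R) (s : S) : R :=
  limn (pseries (fun k => iter k A f s / k`!%:R) t).

Section exp_op.
Context {R : realType} {S : choiceType} (D : set S) (W : S -> R) (C K : R)
  (A : (S -> R) -> S -> R) (f : S -> R).
Hypothesis W0 : forall s, D s -> 0 <= W s.
Hypothesis C0 : 0 <= C.
Hypothesis K0 : 0 <= K.
Hypothesis AC : finitary_op D W C A.
Hypothesis fK : forall s, D s -> `|f s| <= K * W s.

Lemma iter_finitary_op_bound k s : D s -> `|iter k A f s| <= K * C ^+ k * W s.
Proof.
elim: k s => [|k ih] s Ds /=; first by rewrite mulr1 fK.
have KC : 0 <= K * C ^+ k by rewrite mulr_ge0 // exprn_ge0.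
have := finitary_bound KC (AC Ds) ih; congr (_ <= _).
by rewrite exprS; ring.
Qed.

(** Coefficients of the [m]-th derivative of the series: termwise differentiation turns [coef m]
    into [coef m.+1]. Differentiating a power series below requires convergence for [m] = 0, 1,
    2. *)
Let coef (m : nat) s k := iter (k + m) A f s / k`!%:R.

Lemma exp_op_term_bound m s t k : D s ->
  `|coef m s k * t ^+ k| <= K * C ^+ m * W s * exp_coeff (C * `|t|) k.
Proof.
move=> Ds; rewrite /exp_coeff /coef normrM normrX normrM normfV normr_nat.
rewrite /= exprMn.
have := iter_finitary_op_bound (k + m) Ds; rewrite exprD => h.
have h1 : 0 <= k`!%:R^-1 * `|t| ^+ k :> R by rewrite mulr_ge0 ?exprn_ge0 ?invr_ge0.
by have := ler_wpM2r h1 h; congr (_ <= _); ring.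
Qed.

Lemma is_cvg_exp_op m s t : D s -> cvgn (pseries (coef m s) t).
Proof.
move=> Ds; apply: normed_cvg; rewrite /normed_series_of /=.
apply: (@series_le_cvg _ _ (fun k => K * C ^+ m * W s * exp_coeff (C * `|t|) k)) => //.
- by move=> k; rewrite !mulr_ge0 ?exprn_ge0 ?W0 ?invr_ge0 ?mulr_ge0.
- by move=> k; exact: exp_op_term_bound.
- by apply: is_cvg_seriesZ; exact: is_cvg_series_exp_coeff.
Qed.

Lemma exp_op_bound s t : D s -> `|exp_op A f t s| <= K * W s * expR (C * `|t|).
Proof.
move=> Ds.
have cv : cvgn (pseries (coef 0 s) t) by exact: is_cvg_exp_op.
have cv2 : cvgn (series (fun k => K * W s * exp_coeff (C * `|t|) k)).
  by apply: is_cvg_seriesZ; exact: is_cvg_series_exp_coeff.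
have nc : cvgn [normed pseries (coef 0 s) t].
  apply: series_le_cvg cv2.
  - by move=> k; exact: normr_ge0.
  - by move=> k; rewrite !mulr_ge0 ?exprn_ge0 ?W0 ?invr_ge0 ?mulr_ge0.
  - by move=> k; rewrite (le_trans (exp_op_term_bound 0 t k Ds)) ?expr0 ?mulr1.
have -> : exp_op A f t s = limn (pseries (coef 0 s) t).
  by rewrite /exp_op /coef; under [in RHS]eq_fun do rewrite addn0.
apply: le_trans (lim_series_norm nc) _.
apply: (@le_trans _ _ (limn (series (fun k => K * W s * exp_coeff (C * `|t|) k)))).
  apply: ler_lim => //; apply: nearW => n; apply: ler_sum => k _.
  by rewrite (le_trans (exp_op_term_bound 0 t k Ds)) ?expr0 ?mulr1.
by rewrite lim_seriesZ //; exact: is_cvg_series_exp_coeff.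
Qed.

Lemma exp_op_deriv t s : D s ->
  is_derive t (1 : R) (fun r => exp_op A f r s) (A (exp_op A f t) s).
Proof.
move=> Ds.
have diffs m : pseries_diffs (coef m s) = coef m.+1 s.
  apply/funext => k; rewrite /pseries_diffs /coef addnS addSn factS natrM invfM.
  by rewrite mulrCA mulVKf // pnatr_eq0.
have -> : (fun r => exp_op A f r s) = (fun r => limn (pseries (coef 0 s) r)).
  by apply/funext => r; rewrite /exp_op /coef; under [in RHS]eq_fun do rewrite addn0.
suff <- : limn (pseries (pseries_diffs (coef 0 s)) t) = A (exp_op A f t) s.
  apply: (@pseries_snd_diffs _ _ (`|t| + 1)).
  - exact: is_cvg_exp_op.
  - by rewrite diffs; exact: is_cvg_exp_op.
  - by rewrite !diffs; exact: is_cvg_exp_op.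
  - by rewrite [ltRHS]ger0_norm ?ltrDl // addr_ge0.
rewrite diffs; apply: cvg_lim => //.
(* [A] passes through the limit of the partial sums because its row at [s] is finite. *)
have := @finitary_cvg _ _ _ _ _ _ (fun n z => \sum_(0 <= k < n) (coef 0 z k * t ^+ k))
  (exp_op A f t) (AC Ds).
move=> /(_ _)/wrap[z Dz|].
  have := @is_cvg_exp_op 0 z t Dz; rewrite /exp_op /coef /pseries /series /=.
  by under eq_fun do under eq_bigr do rewrite addn0.
apply: cvg_trans; apply: near_eq_cvg; apply: nearW => n.
rewrite (finitary_psum _ _ (AC Ds)) /pseries /series /=.
apply: eq_bigr => k _; rewrite /coef addn0 addn1 /=.
rewrite (finitary_scale (t ^+ k) (fun z => iter k A f z / k`!%:R) (AC Ds)).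
by rewrite (finitary_scale _ _ (AC Ds)).
Qed.

Lemma exp_op0 s : exp_op A f 0 s = f s.
Proof.
rewrite /exp_op; apply: cvg_lim => //.
apply: (@cvg_near_cst _ _ _ _ _ _ ); near=> n.
have n0 : (0 < n)%N by near: n; exact: nbhs_infty_gt.
rewrite /pseries /series /= -(prednK n0) big_nat_recl // big1 => [|i _].
  by rewrite fact0 !mulr1 divr1 addr0.
by rewrite exprS mul0r mulr0.
Unshelve. all: by end_near. Qed.

End exp_op.

(** * One-sided derivatives and a weighted Gronwall estimate *)

(** One-sided notions fit transition functions: their rates are right derivatives at 0, which the
    semigroup property carries to every time. *)
Definition right_derivative (R : realType) (phi : R -> R) (t a : R) : Prop :=
  (phi (t + h) - phi t) / h @[h --> 0^'+] --> a.

Definition left_continuous (R : realType) (phi : R -> R) (t : R) : Prop :=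
  phi (t - h) @[h --> 0^'+] --> phi t.

Section right_derivative.
Context {R : realType}.
Implicit Types (phi psi : R -> R) (t a b c : R).

Lemma right_derivativeB phi psi t a b :
  right_derivative phi t a -> right_derivative psi t b ->
  right_derivative (fun r => phi r - psi r) t (a - b).
Proof.
move=> ha hb; rewrite /right_derivative.
have -> : (fun h => (phi (t + h) - psi (t + h) - (phi t - psi t)) / h) =
   (fun h => (phi (t + h) - phi t) / h - (psi (t + h) - psi t) / h).
  by apply/funext => h; rewrite -mulrBl; congr (_ / _); ring.
exact: cvgB.
Qed.

Lemma right_derivativeZ phi t a c :
  right_derivative phi t a -> right_derivative (fun r => c * phi r) t (c * a).
Proof.
move=> ha; rewrite /right_derivative.
under eq_fun do rewrite -mulrBr -mulrA.
by apply: cvgM => //; exact: cvg_cst.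
Qed.

Lemma left_continuousB phi psi t : left_continuous phi t -> left_continuous psi t ->
  left_continuous (fun r => phi r - psi r) t.
Proof. by move=> ? ?; apply: cvgB. Qed.

Lemma left_continuousZ phi t c :
  left_continuous phi t -> left_continuous (fun r => c * phi r) t.
Proof. by move=> ?; apply: cvgM => //; exact: cvg_cst. Qed.

Lemma has_derivative_RplusP phi t a : has_derivative_Rplus phi t a <->
  forall e, 0 < e -> exists2 d, 0 < d & forall r, 0 <= r -> r != t -> `|r - t| < d ->
    `|a - (phi r - phi t) / (r - t)| < e.
Proof.
rewrite /has_derivative_Rplus; split.
  move=> /cvgrPdist_lt h e /h; rewrite !near_withinE => /nbhs_ballP[d /= d0 hd].
  by exists d => // r r0 rt rd; apply: hd => //; rewrite /ball /= distrC.
move=> h; apply/cvgrPdist_lt => e /h [d d0 hd]; rewrite !near_withinE.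
apply/nbhs_ballP; exists d => //= r; rewrite /ball /= distrC => rd rt r0.
exact: hd.
Qed.

Lemma is_derive_has_derivative_Rplus phi t a :
  is_derive t (1 : R) phi a -> has_derivative_Rplus phi t a.
Proof.
move=> [+ <-]; rewrite /derivable => /cvgrPdist_lt h; apply/has_derivative_RplusP => e e0.
have := h e e0; rewrite near_withinE => /nbhs_ballP[d /= d0 hd].
exists d => // r r0 rt rd.
have := hd (r - t); rewrite /ball /= sub0r normrN subr_eq0 => /(_ rd rt).
by rewrite /GRing.scale /= mulr1 subrK mulrC.
Qed.

Lemma has_derivative_Rplus_lipschitz phi t a : has_derivative_Rplus phi t a ->
  exists2 d, 0 < d & forall r, 0 <= r -> `|r - t| < d ->
    `|phi r - phi t| <= (`|a| + 1) * `|r - t|.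
Proof.
move=> /has_derivative_RplusP /(_ 1 ltr01) [d d0 hd]; exists d => // r r0 rd.
have [->|rt] := eqVneq r t; first by rewrite !subrr normr0 mulr0.
have := hd r r0 rt rd; set x := (_ / _) => hx.
have -> : phi r - phi t = x * (r - t) by rewrite /x divfK // subr_eq0.
rewrite normrM ler_wpM2r // -[x](subrK a) addrC.
by apply: le_trans (ler_normD _ _) _; rewrite lerD2l distrC ltW.
Qed.

Lemma has_derivative_Rplus_right phi t a : 0 <= t ->
  has_derivative_Rplus phi t a -> right_derivative phi t a.
Proof.
move=> t0 /has_derivative_RplusP hphi; apply/cvgrPdist_lt => e /hphi[d d0 hd].
near=> h.
have h0 : 0 < h by near: h; exact: nbhs_right_gt.
have hlt : h < d by near: h; exact: nbhs_right_lt.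
have := hd (t + h); rewrite addrAC subrr add0r; apply.
- by rewrite addr_ge0 // ltW.
- by rewrite -subr_eq0 addrAC subrr add0r gt_eqF.
- by rewrite gtr0_norm.
Unshelve. all: by end_near. Qed.

Lemma has_derivative_Rplus_continuous phi t a : has_derivative_Rplus phi t a ->
  phi r @[r --> within [set r | 0 <= r] (nbhs t)] --> phi t.
Proof.
move=> /has_derivative_Rplus_lipschitz[d d0 hd]; apply/cvgrPdist_lt => e e0.
have K0 : 0 < `|a| + 1 by rewrite ltr_wpDl.
rewrite near_withinE; apply/nbhs_ballP; exists (Num.min d (e / (`|a| + 1))).
  by rewrite /= lt_min d0 divr_gt0.
move=> r; rewrite /ball /= distrC lt_min => /andP[rd re] r0.
by rewrite distrC; apply: le_lt_trans (hd r r0 rd) _; rewrite mulrC -ltr_pdivlMr.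
Qed.

Lemma has_derivative_Rplus_left_continuous phi t a : 0 < t ->
  has_derivative_Rplus phi t a -> left_continuous phi t.
Proof.
move=> t0 /has_derivative_Rplus_continuous/cvgrPdist_lt hphi.
apply/cvgrPdist_lt => e /hphi; rewrite near_withinE => /nbhs_ballP[d /= d0 hd].
near=> h.
have h0 : 0 < h by near: h; exact: nbhs_right_gt.
have hlt : h < d by near: h; exact: nbhs_right_lt.
have ht : h < t by near: h; exact: nbhs_right_lt.
apply: hd; last by rewrite subr_ge0 ltW.
by rewrite /ball /= opprB addrC subrK gtr0_norm.
Unshelve. all: by end_near. Qed.

(* Real induction: the set of r up to which phi stays below phi 0 + e r is
   closed by left continuity and open to the right by the derivative. *)
Lemma right_derivative_le0 phi (a : R -> R) T : 0 <= T ->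
  (forall t, 0 <= t < T -> right_derivative phi t (a t) /\ a t <= 0) ->
  (forall t, 0 < t <= T -> left_continuous phi t) -> phi T <= phi 0.
Proof.
move=> T0 dphi lphi; apply/ler_addgt0Pr => e0 e0_gt0.
(* Slope chosen so that the slack accumulated up to [T] is at most [e0]. *)
pose e := e0 / (T + 1).
have T1 : 0 < T + 1 by rewrite ltr_wpDl.
have e_gt0 : 0 < e by rewrite divr_gt0.
suff: phi T <= phi 0 + e * T.
  move=> /le_trans; apply; rewrite lerD2l /e -mulrA ler_piMr ?(ltW e0_gt0) //.
  by rewrite mulrC ler_pdivrMr // mul1r lerDl.
pose E := [set t | 0 <= t <= T /\ forall r, 0 <= r <= t -> phi r <= phi 0 + e * r].
have E0 : E 0.
  split; first by rewrite lexx.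
  by move=> r /le_anti <-; rewrite mulr0 addr0.
have supE : has_sup E.
  by split; [exists 0|exists T => t [/andP[]]].
pose c := sup E.
have c0 : 0 <= c by apply: sup_upper_bound.
have cT : c <= T by apply: ge_sup; [exists 0|move=> t [/andP[]]].
have below r : 0 <= r < c -> phi r <= phi 0 + e * r.
  move=> /andP[r0 rc]; have [t [_ Et] rt] := sup_gt (ex_intro _ _ E0) rc.
  by apply: Et; rewrite r0 ltW.
have atc : phi c <= phi 0 + e * c.
  have [c_gt0|] := ltP 0 c; last first.
    by move=> c_le0; have -> : c = 0 by [apply/le_anti; rewrite c0 c_le0]; rewrite mulr0 addr0.
  have lc : left_continuous phi c by apply: lphi; rewrite c_gt0.
  rewrite -(cvg_lim _ lc) //; apply: limr_le; first by apply/cvg_ex; exists (phi c).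
  near=> h.
  have h0 : 0 < h by near: h; exact: nbhs_right_gt.
  have hc : h < c by near: h; exact: nbhs_right_lt.
  apply: le_trans (below _ _) _; first by rewrite subr_ge0 ltW //= ltrBlDr ltrDl.
  by rewrite lerD2l ler_pM2l // gerBl ltW.
have [cltT|] := ltP c T; last first.
  by move=> Tc; have <- : c = T by [apply/le_anti; rewrite cT Tc].
have [dc ac] : right_derivative phi c (a c) /\ a c <= 0 by apply: dphi; rewrite c0.
have : \forall h \near 0^'+, (phi (c + h) - phi c) / h < e.
  by apply: (cvgr_lt _ dc); exact: le_lt_trans ac e_gt0.
rewrite /at_right near_withinE => /nbhs_ballP[/= d d0 hd].
(* Stays strictly inside the radius where the difference quotient is below [e], and does not go
   beyond [T]. *)
pose h1 := Num.min (d / 2) (T - c).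
have h1_gt0 : 0 < h1 by rewrite lt_min subr_gt0 cltT divr_gt0.
have : E (c + h1).
  split.
    by rewrite addr_ge0 ?(ltW h1_gt0) //= -lerBrDl ge_min lexx orbT.
  move=> r /andP[r0 rh]; have [rc|cr|->] := ltgtP r c; last exact: atc.
    by apply: below; rewrite r0.
  have rc0 : 0 < r - c by rewrite subr_gt0.
  have := hd (r - c); rewrite /ball /= sub0r normrN gtr0_norm // => /(_ _ rc0).
  have -> : r - c < d.
    apply: (@le_lt_trans _ _ h1); first by rewrite lerBlDl.
    apply: (@le_lt_trans _ _ (d / 2)); first by rewrite ge_min lexx.
    by rewrite gtr_pMr // invf_lt1 // ltr1n.
  move=> /(_ isT); rewrite [c + _]addrC subrK ltr_pdivrMr // ltrBlDl => /ltW h.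
  by apply: le_trans h _; rewrite -lerBrDr; apply: le_trans atc _; lra.
move=> /(sup_upper_bound supE); rewrite -/c gerDl => h; exfalso.
by move: (lt_le_trans h1_gt0 h); rewrite ltxx.
Unshelve. all: by end_near. Qed.

End right_derivative.

(* If |w t| <= B e^(2 C t) W then the mean value inequality improves B to
   eps + B / 2; iterating, B tends to 2 eps. *)
Lemma gronwall_op (R : realType) (S : choiceType) (D : set S) (W : S -> R) (C : R)
    (A : (S -> R) -> S -> R) (w : R -> S -> R) (T K eps : R) :
  0 < C -> 0 <= K -> 0 <= eps -> (forall s, D s -> 0 <= W s) ->
  finitary_op D W C A ->
  (forall t s, D s -> 0 <= t -> right_derivative (w^~ s) t (A (w t) s)) ->
  (forall t s, D s -> 0 < t -> left_continuous (w^~ s) t) ->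
  (forall t s, D s -> 0 <= t <= T -> `|w t s| <= K * W s) ->
  (forall s, D s -> `|w 0 s| <= eps * W s) ->
  forall t s, D s -> 0 <= t <= T -> `|w t s| <= 2 * eps * expR (2 * C * t) * W s.
Proof.
move=> C0 K0 eps0 W0 AC dw lw wK w0.
(* Iterates of B -> eps + B / 2, with fixed point 2 eps. The a priori bound [K] enters only through
   the vanishing term. *)
pose B k := 2 * eps + K * (2^-1) ^+ k.
have half0 k : 0 <= (2^-1 : R) ^+ k by rewrite exprn_ge0 // invr_ge0.
have B0 k : 0 <= B k by rewrite addr_ge0 ?mulr_ge0.
have main k : forall t s, D s -> 0 <= t <= T ->
    `|w t s| <= B k * expR (2 * C * t) * W s.
  elim: k => [|k ih] t s Ds tT; have Ws := W0 _ Ds.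
    apply: le_trans (wK _ _ Ds tT) _; rewrite ler_wpM2r //.
    apply: (@le_trans _ _ (B 0 * 1)).
      by rewrite mulr1 /B expr0 mulr1 lerDr mulr_ge0.
    rewrite ler_wpM2l // -expR0 ler_expR; case/andP: tT => t0 _.
    by rewrite !mulr_ge0 // ltW.
  case/andP: tT => t0 tT.
  have e1 : 1 <= expR (2 * C * t).
    by rewrite -expR0 ler_expR !mulr_ge0 // ltW.
  suff sgn (z : R) : `|z| = 1 -> z * w t s <= B k.+1 * expR (2 * C * t) * W s.
    rewrite ler_norml lerNl -mulN1r -[X in _ && (X <= _)]mul1r.
    by rewrite !sgn ?normrN1 ?normr1.
  move=> z1.
  (* By induction [z * A (w r) s] is at most [C * B k * expR (2 * C * r) * W s], which is exactly
     the derivative of the subtracted term. The exponent 2 C makes the integration gain the factor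
     1/2. *)
  pose phi r := z * w r s - B k / 2 * W s * expR (2 * C * r).
  pose a r := z * A (w r) s - B k / 2 * W s * (2 * C * expR (2 * C * r)).
  have dexp r : is_derive r (1 : R) (fun r => expR (2 * C * r)) (2 * C * expR (2 * C * r)).
    apply: is_derive_eq; rewrite /GRing.scale /=; ring.
  have : phi t <= phi 0.
    apply: (@right_derivative_le0 _ _ a) => // r /andP[r0 rt].
      split.
        apply: right_derivativeB; first by apply: right_derivativeZ; exact: dw.
        by apply: right_derivativeZ; apply: has_derivative_Rplus_right => //; exact: is_derive_has_derivative_Rplus.
      rewrite /a subr_le0; apply: le_trans (ler_norm _) _; rewrite normrM z1 mul1r.
      have BE : 0 <= B k * expR (2 * C * r) by rewrite mulr_ge0 ?expR_ge0.
      have rT : 0 <= r <= T by rewrite r0 (le_trans (ltW rt)).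
      have := finitary_bound BE (AC _ Ds) (fun s' Ds' => ih r s' Ds' rT).
      by move=> /le_trans; apply; rewrite le_eqVlt; apply/orP; left; apply/eqP; field.
    apply: left_continuousB; first by apply: left_continuousZ; exact: lw.
    by apply: left_continuousZ; apply: (has_derivative_Rplus_left_continuous r0 (is_derive_has_derivative_Rplus (dexp r))).
  rewrite /phi mulr0 expR0 mulr1.
  have z0 : z * w 0 s <= eps * W s.
    by apply: le_trans (ler_norm _) _; rewrite normrM z1 mul1r w0.
  have -> : B k.+1 = eps + B k / 2 by rewrite /B exprS; field.
  have : eps * W s * 1 <= eps * W s * expR (2 * C * t) by rewrite ler_wpM2l ?mulr_ge0.
  have : 0 <= B k * W s by rewrite mulr_ge0.
  lra.
move=> t s Ds tT.
have Bcvg : B k * expR (2 * C * t) * W s @[k --> \oo] -->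
    (2 * eps + K * 0) * expR (2 * C * t) * W s.
  apply: cvgM; last exact: cvg_cst.
  apply: cvgM; last exact: cvg_cst.
  apply: cvgD; first exact: cvg_cst.
  apply: cvgM; first exact: cvg_cst.
  by apply: cvg_expr; rewrite ger0_norm ?invr_ge0 // invf_lt1 // ltr1n.
rewrite mulr0 addr0 in Bcvg; rewrite -(cvg_lim _ Bcvg) //.
apply: limr_ge; first by apply/cvg_ex; exists (2 * eps * expR (2 * C * t) * W s).
by apply: nearW => k; exact: main.
Qed.

(** * The generator and the dual operator are finitary *)

(** Only the gap to the immediate predecessor has to be checked: the coordinates before it are
    smaller still. *)
Lemma weyl_shift_left (n l : nat) (x : {ffun 'I_n -> int}) (i : 'I_n) :
  weyl n l x -> 1 < x i -> (forall j : 'I_n, i = j.+1 :> nat -> 1 < x i - x j) ->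
  weyl n l (shift_coord x i (-1)).
Proof.
move=> [xb xm] xi1 gap; split => [j|j k jk].
  rewrite ffunE; have := xb j; case: eqP => [->|//]; move: xi1; lia.
rewrite !ffunE; have xjk := xm j k jk.
case: (j =P i) => ji; case: (k =P i) => ki //; first by move: jk; rewrite ji ki ltnn.
  by move: xjk; lia.
have i0 : (i.-1 < n)%N by apply: leq_ltn_trans (ltn_ord i); exact: leq_pred.
pose i' := Ordinal i0.
have i'i : i = i'.+1 :> nat by rewrite /=; move: jk; rewrite ki; lia.
have := gap i' i'i; have : x j <= x i'.
  have [->//|ji'] := eqVneq j i'.
  apply/ltW/xm; move: jk; rewrite ki.
  by have : (j : nat) <> i' by [move=> /val_inj; apply/eqP]; rewrite /=; lia.
by rewrite ki; lia.
Qed.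

Lemma weyl_shift_right (n l : nat) (x : {ffun 'I_n -> int}) (i : 'I_n) :
  weyl n l x -> x i < l%:Z -> (forall j : 'I_n, j = i.+1 :> nat -> 1 < x j - x i) ->
  weyl n l (shift_coord x i 1).
Proof.
move=> [xb xm] xi1 gap; split => [j|j k jk].
  rewrite ffunE; have := xb j; case: eqP => [->|//]; move: xi1; lia.
rewrite !ffunE; have xjk := xm j k jk.
case: (j =P i) => ji; case: (k =P i) => ki //; first by move: jk; rewrite ji ki ltnn.
  have i0 : (i.+1 < n)%N by apply: leq_ltn_trans (ltn_ord k); rewrite -ji.
  pose i' := Ordinal i0.
  have := gap i' erefl; have : x i' <= x k.
    have [->//|ki'] := eqVneq k i'.
    apply/ltW/xm; move: jk; rewrite ji.
    by have : (k : nat) <> i' by [move=> /val_inj; apply/eqP]; rewrite /=; lia.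
  by rewrite ji; lia.
by move: xjk; lia.
Qed.

Section generator_finitary.
Context {R : realType} (l : nat) (p q alpha beta gamma delta : R).

Lemma finitary_rate (S : choiceType) (D : set S) (W : S -> R) (a K c : R) (s s' : S) :
  D s -> D s' -> 0 <= W s -> 0 <= c -> W s' <= c * W s -> `|a| <= K ->
  finitary D W (K * (c + 1) * W s) (fun f => a * (f s' - f s)).
Proof.
move=> Ds Ds' W0 c0 Wc aK.
apply: finitary_le (finitaryZ a (finitaryB (finitary_eval W Ds') (finitary_eval W Ds))).
have a0 : 0 <= `|a| by [].
apply: (@le_trans _ _ (`|a| * (c * W s + W s))); first by rewrite ler_wpM2l // lerD2r.
rewrite -mulrA mulrDl mul1r ler_wpM2r //.
by rewrite addr_ge0 // mulr_ge0.
Qed.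

(** A weight that one transition multiplies by at most [c] makes the generator bounded: each term
    costs its rate times [c + 1]. *)
Lemma open_asep_generator_finitary (W : state l -> R) (c : R) : 1 <= c ->
  (forall s, 0 <= W s) ->
  (forall s eta k, -1 <= k <= 1 -> W (eta, s.2 + k) <= c * W s) ->
  exists2 C, 0 < C &
    finitary_op setT W C (open_asep_generator p q alpha beta gamma delta).
Proof.
move=> c1 W0 Wc; have c0 : 0 <= c by apply: le_trans c1.
pose C := (\sum_(x < l.-1) \sum_(y < l.-1 | y == x.+1 :> nat) (`|p| + `|q|) +
  \sum_(x < l.-1 | x == 0%N :> nat) (`|alpha| + `|gamma|) +
  \sum_(x < l.-1 | x.+1 == l.-1 :> nat) (`|delta| + `|beta|)) * (c + 1).
have C0 : 0 <= C.
  apply: mulr_ge0; last by rewrite addr_ge0.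
  have nn (a b : R) : 0 <= `|a| + `|b| by rewrite addr_ge0.
  apply: addr_ge0; first apply: addr_ge0; apply: sumr_ge0 => x _ //.
  exact: sumr_ge0.
(* The added 1 keeps the constant positive even when all rates vanish. *)
exists (C + 1) => [|s _]; first by rewrite ltr_wpDl.
have Wc0 eta : W (eta, s.2) <= c * W s by rewrite -[s.2]addr0 Wc.
apply: (@finitary_le _ _ _ _ (C * W s)); first by rewrite ler_wpM2r // lerDl.
rewrite /C mulrAC !mulrDl !mulr_suml.
have bd (b : bool) : `|1 - b%:R : R| <= 1 by case: b; rewrite ?subrr ?normr0 ?subr0 ?normr1.
have bd' (b : bool) : `|b%:R : R| <= 1 by case: b; rewrite ?normr0 ?normr1.
have mulbd (a b : R) : `|b| <= 1 -> `|a * b| <= `|a| by move=> ?; rewrite normrM ler_piMr.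
have mulbd2 (a b : R) : `|a| <= 1 -> `|b| <= 1 -> `|a * b| <= 1.
  by move=> a1 b1; apply: le_trans (mulbd _ _ b1) a1.
apply: finitaryD; first apply: finitaryD.
- apply: finitary_sum => x _; rewrite !mulr_suml; apply: finitary_sum => y _.
  rewrite mulrAC; apply: finitary_rate => //.
  by apply: le_trans (ler_normD _ _) _; rewrite lerD // mulbd // mulbd2.
- apply: finitary_sum => x _; rewrite mulrAC; apply: finitary_rate => //.
  by apply: le_trans (ler_normD _ _) _; rewrite lerD // mulbd.
- apply: finitary_sum => x _; rewrite mulrAC 2!mulrDl; apply: finitaryD.
    by apply: finitary_rate => //; [exact: Wc|exact: mulbd].
  by apply: finitary_rate => //; [exact: Wc|exact: mulbd].
Qed.

Lemma Dop_finitary (n : nat) (rho0 rhol : R) : exists2 C, 0 < C &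
  finitary_op (weyl n l) (fun=> 1) C (Dop l p q rho0 rhol).
Proof.
pose B := `|p| * 2 + `|q| * 2 + `|(p - q) * rho0| + `|(p - q) * rhol|.
have B0 : 0 <= B by rewrite !addr_ge0 ?mulr_ge0.
pose C := \sum_(i < n) \sum_(j < n) B + \sum_(i < n) \sum_(j < n) B +
  \sum_(i < n) B + \sum_(i < n) B.
exists (C + 1).
  by rewrite ltr_wpDl // !addr_ge0 // !sumr_ge0 // => i _; rewrite sumr_ge0.
move=> x wx; have [xb xm] := wx; rewrite mulr1.
have wider (P : pred 'I_n) : \sum_(i | P i) B <= \sum_(i < n) B.
  by rewrite big_mkcond; apply: ler_sum => i _; case: ifP.
have rate2 (a : R) y : weyl n l y ->
    finitary (weyl n l) (fun=> 1) (`|a| * 2) (fun f => a * (f y - f x)).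
  move=> wy.
  have := @finitary_rate _ (weyl n l) (fun=> 1) a `|a| 1 x y wx wy.
  by rewrite !mulr1; apply.
have rate (a : R) y : weyl n l y -> `|a| * 2 <= B ->
    finitary (weyl n l) (fun=> 1) B (fun f => a * (f y - f x)).
  by move=> wy aB; exact: finitary_le aB (rate2 _ _ wy).
have := normr_ge0 q; have := normr_ge0 p.
have := normr_ge0 ((p - q) * rho0); have := normr_ge0 ((p - q) * rhol) => nl n0 np nq.
have p2 : `|p| * 2 <= B by rewrite /B; lra.
have q2 : `|q| * 2 <= B by rewrite /B; lra.
apply: (@finitary_le _ _ _ _ C); first by rewrite lerDl.
apply: finitaryD; first apply: finitaryD; first apply: finitaryD.
- apply: finitary_sum => i _; apply: finitary_le (wider _) _.
  apply: finitary_sum => j /andP[/eqP ij gap]; apply: rate p2.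
  (* The bound [1 < x i] follows from the gap, since [x j] is at least 1. *)
  apply: weyl_shift_left => // [|j' ij']; first by have := xb j; move: gap; lia.
  by have -> : j' = j by apply: val_inj; move: ij'; rewrite /= ij => -[].
- apply: finitary_sum => i _; apply: finitary_le (wider _) _.
  apply: finitary_sum => j /andP[/eqP ij gap]; apply: rate q2.
  apply: weyl_shift_right => // [|j' ij']; first by have := xb j; move: gap; lia.
  by have -> : j' = j by apply: val_inj; rewrite /= ij.
- apply: finitary_le (wider _) _; apply: finitary_sum => i /eqP i0.
  apply: finitary_le (_ : `|p| * 2 + `|(p - q) * rho0| <= _) _.
    by rewrite /B; lra.
  apply: finitaryB.
    apply: finitary_if => [|xi1]; first by rewrite mulr_ge0.
    apply: rate2; apply: weyl_shift_left => // j ij.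
    by move: i0; rewrite ij.
  apply: finitary_if => // _; rewrite -[X in finitary _ _ X]mulr1.
  exact: (finitaryZ _ (finitary_eval _ wx)).
- apply: finitary_le (wider _) _; apply: finitary_sum => i /eqP i0.
  apply: finitary_le (_ : `|q| * 2 + `|(p - q) * rhol| <= _) _.
    by rewrite /B; lra.
  apply: finitaryD.
    apply: finitary_if => [|xi1]; first by rewrite mulr_ge0.
    apply: rate2; apply: weyl_shift_right => // j ij.
    by have := ltn_ord j; rewrite ij i0 ltnn.
  apply: finitary_if => // _; rewrite -[X in finitary _ _ X]mulr1.
  exact: (finitaryZ _ (finitary_eval _ wx)).
Qed.

End generator_finitary.

(** * Duality *)

Section height.
Context (l : nat).
Implicit Types (s : state l) (y z : int).

Lemma NheightE s z :
  Nheight s z = \sum_(i < l.-1) (z <= i.+1%:Z)%R%:Z * (s.1 i : nat)%:Z + s.2.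
Proof.
rewrite /Nheight big_mkcond; congr (_ + _); apply: eq_bigr => i _.
by case: ifP; rewrite ?mul1r ?mul0r.
Qed.

Lemma Nheight_succ s z :
  Nheight s z = Nheight s (z + 1) + \sum_(i < l.-1 | i.+1%:Z == z) (s.1 i : nat)%:Z.
Proof.
rewrite !NheightE [RHS]addrAC; congr (_ + _); rewrite [X in _ + X]big_mkcond -big_split.
apply: eq_bigr => i _ /=; case: (s.1 i); case: eqP; lia.
Qed.

(** Only the height at the right end of the bond counts exactly one of the two exchanged sites. *)
Lemma Nheight_swap (eta : config l) (N : int) (x y : 'I_l.-1) z : y = x.+1 :> nat ->
  Nheight (swap_sites eta x y, N) z =
  Nheight (eta, N) z + (z == y.+1%:Z)%:Z * ((eta x : nat)%:Z - (eta y : nat)%:Z).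
Proof.
move=> yx; have xy : y != x by apply/eqP => /(congr1 val) /=; lia.
rewrite !NheightE /= (bigD1 x) //= (bigD1 y) //= [in RHS](bigD1 x) //= [in RHS](bigD1 y) //=.
rewrite !ffunE tpermL tpermR.
under eq_bigr => i /andP[ix iy] do rewrite ffunE tpermD // 1?eq_sym //.
case: (eta x); case: (eta y); case: eqP; lia.
Qed.

Lemma Nheight_flip (eta : config l) (N : int) (x : 'I_l.-1) z :
  Nheight (flip_site eta x, N) z =
  Nheight (eta, N) z + (z <= x.+1%:Z)%R%:Z * (if eta x then -1 else 1).
Proof.
rewrite !NheightE /= (bigD1 x) //= [in RHS](bigD1 x) //= ffunE eqxx.
under eq_bigr => i ix do rewrite ffunE (negbTE ix).
case: (eta x); case: leP; lia.
Qed.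

Lemma Nheight_addN (eta : config l) (N k : int) z :
  Nheight (eta, N + k) z = Nheight (eta, N) z + k.
Proof. by rewrite /Nheight addrA. Qed.

End height.

Lemma weyl_inj (n l : nat) (x : {ffun 'I_n -> int}) : weyl n l x -> injective x.
Proof.
move=> [_ xm] i j xij; apply: val_inj; case: (ltngtP i j) => // /xm; lia.
Qed.

Section duality.
Context {R : realType} (l n : nat) (p q alpha beta gamma delta : R).
Hypothesis hl : (2 <= l)%N.
Hypothesis q0 : 0 < q.
Hypothesis p0 : 0 < p.
Hypothesis hag : alpha / p + gamma / q = 1.
Hypothesis hbd : beta / p + delta / q = 1.
Let tau := q / p.
Let tau0 : tau != 0. Proof. by rewrite gt_eqF // divr_gt0. Qed.
Let rho0 := alpha / p.
Let rhol := delta / q.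
Implicit Types (s : state l) (x : {ffun 'I_n -> int}).

(** The coordinates of a chamber point are distinct, so at most one of them sits at [y]: the product
    changes by a single factor [k], and the sum has at most one nonzero term. *)
Lemma Hdual_local s s' (y : int) (k : R) x :
  (forall z, 1 <= z <= l%:Z ->
     Qheight tau s' z = (if z == y then k else 1) * Qheight tau s z) ->
  weyl n l x ->
  Hdual tau s' x - Hdual tau s x =
  \sum_(i < n) (x i == y)%:R * ((k - 1) * Hdual tau s x).
Proof.
move=> Qs wx; have [xb _] := wx; have xI := weyl_inj wx.
have HE : Hdual tau s' x = (\prod_(i < n) if x i == y then k else 1) * Hdual tau s x.
  by rewrite /Hdual -big_split; apply: eq_bigr => i _; rewrite Qs.
rewrite HE -mulr_suml mulrA.
have [[i0 /eqP xi0]|none] := pselect (exists i, x i == y).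
  have other i : i != i0 -> (x i == y) = false.
    by move=> ii; apply: contra_neqF ii => /eqP; rewrite -xi0 => /xI.
  rewrite (bigD1 i0) //= [in RHS](bigD1 i0) //= xi0 eqxx.
  rewrite [X in k * X]big1 => [|i /other ->//].
  by rewrite [X in 1 + X]big1 => [|i /other ->//]; ring.
have other i : (x i == y) = false by apply/negP => xi; apply: none; exists i.
by rewrite big1 => [|i _]; rewrite ?other // big1 => [|i _]; rewrite ?other //; ring.
Qed.

Lemma tau_up : p * (tau - 1) = q - p.
Proof. by rewrite /tau; field; rewrite gt_eqF. Qed.

Lemma tau_down : q * (tau^-1 - 1) = p - q.
Proof. by rewrite /tau; field; rewrite !gt_eqF. Qed.

(** A right jump multiplies [Q] at the right end of the bond by [tau], a left jump by its inverse.
    By [tau_up] and [tau_down] both cases give [p - q] times the difference of occupations. *)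
Lemma generator_bond s (a b : 'I_l.-1) x : weyl n l x -> b = a.+1 :> nat ->
  (p * ((s.1 a)%:R * (1 - (s.1 b)%:R)) + q * ((s.1 b)%:R * (1 - (s.1 a)%:R)))
     * (Hdual tau (swap_sites s.1 a b, s.2) x - Hdual tau s x) =
  \sum_(i < n) (x i == b.+1%:Z)%:R *
    ((p - q) * ((s.1 b)%:R - (s.1 a)%:R) * Hdual tau s x).
Proof.
case: s => eta N wx ba /=.
rewrite (@Hdual_local (eta, N) _ b.+1%:Z (tau ^ ((eta a : nat)%:Z - (eta b : nat)%:Z))) //.
  rewrite mulr_sumr; apply: eq_bigr => i _; rewrite mulrCA; congr (_ * _).
  rewrite mulrA; congr (_ * _).
  have up := tau_up; have down := tau_down.
  case: (eta a); case: (eta b) => /=; rewrite ?subrr ?subr0 ?sub0r ?expr0z ?expr1z ?exprN1;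
    lra.
move=> z zb; rewrite /Qheight Nheight_swap // expfzDr // mulrC; congr (_ * _).
by case: eqP => _; rewrite ?mul1r // mul0r expr0z.
Qed.

(** Creation contributes [alpha * (tau - 1) = - (p - q) * rho0], annihilation [gamma * (tau^-1 - 1)
    = (p - q) * gamma / q]. The relation between [alpha] and [gamma] turns the latter into
    [(p - q) * (1 - rho0)], so that the reservoir acts like a site of occupation [rho0]. *)
Lemma generator_left s (a : 'I_l.-1) x : weyl n l x -> a = 0%N :> nat ->
  (alpha * (1 - (s.1 a)%:R) + gamma * (s.1 a)%:R)
     * (Hdual tau (flip_site s.1 a, s.2) x - Hdual tau s x) =
  \sum_(i < n) (x i == 1)%:R *
    ((p - q) * ((s.1 a)%:R - rho0) * Hdual tau s x).
Proof.
case: s => eta N wx a0 /=.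
rewrite (@Hdual_local (eta, N) _ 1 (tau ^ (if eta a then -1 else 1))) //.
  rewrite mulr_sumr; apply: eq_bigr => i _; rewrite mulrCA; congr (_ * _).
  rewrite mulrA; congr (_ * _); rewrite /rho0.
  have p0' : p != 0 by rewrite gt_eqF.
  have q0' : q != 0 by rewrite gt_eqF.
  have gE : gamma = q * (1 - alpha / p) by rewrite -hag addrAC subrr add0r mulrC divfK.
  case: (eta a) => /=; rewrite ?expr1z ?exprN1 ?gE /tau; field; by rewrite ?p0'.
move=> z zb; rewrite /Qheight Nheight_flip // expfzDr // mulrC; congr (_ * _).
have -> : (z <= a.+1%:Z) = (z == 1) by rewrite a0; move: zb; lia.
by case: eqP => _; rewrite ?mul1r // mul0r expr0z.
Qed.

(** The flip at site [l - 1] shifts all heights up to that site, and the change of N shifts every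
    height back: only the height at [l] changes in the end. *)
Lemma generator_right s (a : 'I_l.-1) x : weyl n l x -> a.+1 = l.-1 :> nat ->
  delta * (1 - (s.1 a)%:R) * (Hdual tau (flip_site s.1 a, s.2 - 1) x - Hdual tau s x)
  + beta * (s.1 a)%:R * (Hdual tau (flip_site s.1 a, s.2 + 1) x - Hdual tau s x) =
  \sum_(i < n) (x i == l%:Z)%:R *
    ((p - q) * (rhol - (s.1 a)%:R) * Hdual tau s x).
Proof.
case: s => eta N wx a0 /=.
have p0' : p != 0 by rewrite gt_eqF.
have q0' : q != 0 by rewrite gt_eqF.
have dE : delta = q * (1 - beta / p) by rewrite -hbd addrAC subrr add0r mulrC divfK.
have key (k : int) : k = (if eta a then 1 else -1) ->
  forall z, 1 <= z <= l%:Z -> Qheight tau (flip_site eta a, N + k) z =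
     (if z == l%:Z then tau ^ k else 1) * Qheight tau (eta, N) z.
  move=> kE z zb; rewrite /Qheight Nheight_addN Nheight_flip -addrA expfzDr // mulrC.
  congr (_ * _); have -> : (z <= a.+1%:Z) = (z != l%:Z) by rewrite a0; move: zb hl; lia.
  by rewrite kE; case: eqP => _; case: (eta a).
case ea: (eta a) => /=.
  rewrite subrr mulr0 mul0r add0r (@Hdual_local (eta, N) _ l%:Z (tau ^ 1)) //.
    rewrite mulr_sumr; apply: eq_bigr => i _; rewrite mulrCA; congr (_ * _).
    rewrite mulrA; congr (_ * _); rewrite expr1z /rhol dE /tau; field.
    by rewrite ?p0' ?q0'.
  by apply: key; rewrite ea.
rewrite mulr0 mul0r addr0 (@Hdual_local (eta, N) _ l%:Z (tau ^ (-1))) //.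
  rewrite mulr_sumr; apply: eq_bigr => i _; rewrite mulrCA; congr (_ * _).
  rewrite mulrA; congr (_ * _); rewrite exprN1 /rhol /tau; field.
  by rewrite ?p0' ?q0'.
by apply: key; rewrite ea.
Qed.

(* Occupation variables extended by the reservoir densities at sites 0 and l. *)
Definition occ s (y : int) : R :=
  if y <= 0 then rho0 else if l%:Z <= y then rhol
  else \sum_(i < l.-1 | i.+1%:Z == y) (s.1 i)%:R.

Lemma occ_site s (a : 'I_l.-1) : occ s a.+1%:Z = (s.1 a)%:R.
Proof.
rewrite /occ ifF; last by apply/negbTE; have := ltn_ord a; move: hl; lia.
by rewrite (big_pred1 a) // => i; rewrite eqz_nat eqSS.
Qed.

(** With the reservoirs as sites 0 and [l], each [c] is the right end of exactly one bond: the left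
    boundary for [c = 1], the right boundary for [c = l], a bulk bond otherwise. *)
Lemma occ_sum s (c : int) : 1 <= c <= l%:Z ->
  \sum_(a < l.-1) \sum_(b < l.-1 | b == a.+1 :> nat)
     (c == b.+1%:Z)%:R * ((s.1 b)%:R - (s.1 a)%:R)
  + \sum_(a < l.-1 | a == 0%N :> nat) (c == 1)%:R * ((s.1 a)%:R - rho0)
  + \sum_(a < l.-1 | a.+1 == l.-1 :> nat) (c == l%:Z)%:R * (rhol - (s.1 a)%:R)
  = occ s c - occ s (c - 1) :> R.
Proof.
move=> /andP[c1 cl].
have lt0 : (0 < l.-1)%N by move: hl; lia.
have ltl : (l.-2 < l.-1)%N by move: hl; lia.
rewrite [X in _ + X + _](big_pred1 (Ordinal lt0)) //.
rewrite [X in _ + _ + X](big_pred1 (Ordinal ltl)); last first.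
  by move=> i; rewrite /= -val_eqE /=; move: hl; lia.
have first0 : (c == 1) || (c == l%:Z) -> \sum_(a < l.-1) \sum_(b < l.-1 | b == a.+1 :> nat)
     (c == b.+1%:Z)%:R * ((s.1 b)%:R - (s.1 a)%:R) = 0 :> R.
  move=> ce; rewrite big1 // => a _; rewrite big1 // => b /eqP ba.
  have -> : (c == b.+1%:Z) = false; last by rewrite mul0r.
  by apply/negbTE; have := ltn_ord b; move: ce ba hl; lia.
have [ce|cn1] := eqVneq c 1.
  rewrite first0 ?ce //; have -> : (1 == l%:Z) = false by move: hl; lia.
  have := occ_site s (Ordinal lt0); rewrite /= => ->.
  by rewrite subrr /occ /= mul1r mul0r add0r addr0.
have [ce|cnl] := eqVneq c l%:Z.
  rewrite first0 ?ce ?eqxx ?orbT //.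
  have -> : occ s l%:Z = rhol.
    by rewrite /occ lexx ifF //; apply/negbTE; move: hl; lia.
  have := occ_site s (Ordinal ltl); rewrite /=.
  have -> : l.-2.+1%:Z = l%:Z - 1 by move: hl; lia.
  by move=> ->; rewrite mul1r mul0r !add0r.
have cb : (`|c|%N.-1 < l.-1)%N by move: c1 cl cnl; lia.
have ca : (`|c|%N.-2 < l.-1)%N by move: c1 cl cnl; lia.
rewrite (bigD1 (Ordinal ca)) //= (big_pred1 (Ordinal cb)); last first.
  by move=> i; rewrite /= -val_eqE /=; move: c1 cn1; lia.
have -> : (c == `|c|%N.-1.+1%:Z) by move: c1; lia.
rewrite big1 ?mul1r ?mul0r ?addr0.
  have := occ_site s (Ordinal cb); have := occ_site s (Ordinal ca); rewrite /=.
  have -> : `|c|%N.-2.+1%:Z = c - 1 by move: c1 cn1; lia.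
  by have -> : `|c|%N.-1.+1%:Z = c by [move: c1; lia]; move=> -> ->.
move=> a; rewrite /= -val_eqE /= => ane; rewrite big1 // => b /eqP ba.
have -> : (c == b.+1%:Z) = false; last by rewrite mul0r.
by move: ane ba c1; lia.
Qed.

Lemma generator_Hdual s x : weyl n l x ->
  open_asep_generator p q alpha beta gamma delta (fun s' => Hdual tau s' x) s =
  (p - q) * (\sum_(i < n) (occ s (x i) - occ s (x i - 1))) * Hdual tau s x.
Proof.
move=> wx; have [xb _] := wx; rewrite /open_asep_generator.
under eq_bigr do under eq_bigr => b /eqP ba do rewrite (generator_bond s wx ba).
under [X in _ + X + _]eq_bigr => a /eqP a0 do rewrite (generator_left s wx a0).
under [X in _ + _ + X]eq_bigr => a /eqP a0 do rewrite (generator_right s wx a0).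
under eq_bigr do rewrite exchange_big.
rewrite exchange_big /= [X in _ + X + _]exchange_big [X in _ + _ + X]exchange_big /=.
rewrite -!big_split /= -mulrA mulrCA mulr_suml.
apply: eq_bigr => i _; rewrite -occ_sum //.
rewrite 2![in RHS]mulrDl ![in RHS]mulr_suml.
congr (_ + _ + _).
- apply: eq_bigr => a _; rewrite mulr_suml; apply: eq_bigr => b _; ring.
- by apply: eq_bigr => a _; ring.
- by apply: eq_bigr => a _; ring.
Qed.

Lemma shift_Hdual s x i (a : int) :
  Hdual tau s (shift_coord x i a) - Hdual tau s x =
  (Qheight tau s (x i + a) - Qheight tau s (x i)) *
  \prod_(j < n | j != i) Qheight tau s (x j).
Proof.
rewrite /Hdual (bigD1 i) //= [X in _ - X](bigD1 i) //= ffunE eqxx mulrBl.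
congr (_ * _ - _); apply: eq_bigr => j ji.
by rewrite ffunE (negbTE ji).
Qed.

Lemma Hdual_split s x i :
  Hdual tau s x = Qheight tau s (x i) * \prod_(j < n | j != i) Qheight tau s (x j).
Proof. by rewrite /Hdual (bigD1 i). Qed.

Lemma Qheight_succ s (y : int) : 1 <= y < l%:Z ->
  exists b : bool, occ s y = b%:R /\ Qheight tau s y = tau ^ (b : nat)%:Z * Qheight tau s (y + 1).
Proof.
move=> yb; have yl : (`|y|%N.-1 < l.-1)%N by move: yb hl; lia.
exists (s.1 (Ordinal yl)).
have yE : `|y|%N.-1.+1%:Z = y by move: yb; lia.
split; first by have := occ_site s (Ordinal yl); rewrite /= yE.
rewrite /Qheight -expfzDr // Nheight_succ addrC; congr (_ ^ (_ + _)).
by rewrite (big_pred1 (Ordinal yl)) // => i; rewrite /= -val_eqE /=; move: yb; lia.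
Qed.

(** [Q] at [x i - 1] is [Q] at [x i] times [tau] to the occupation of [x i - 1]; since that
    occupation is 0 or 1, [tau_up] makes the difference linear in it. *)
Lemma Hdual_left s x (i : 'I_n) : 1 < x i <= l%:Z ->
  p * (Hdual tau s (shift_coord x i (-1)) - Hdual tau s x) =
  - ((p - q) * occ s (x i - 1) * Hdual tau s x).
Proof.
move=> xb; rewrite shift_Hdual (Hdual_split s x i).
have [|b [-> ->]] := @Qheight_succ s (x i - 1); first by move: xb; lia.
have up := tau_up; rewrite subrK.
case: b; rewrite /= ?expr1z ?expr0z; last by ring.
by transitivity (p * (tau - 1) * (Qheight tau s (x i) *
  \prod_(j < n | j != i) Qheight tau s (x j))); [ring|rewrite up; ring].
Qed.

Lemma Hdual_right s x (i : 'I_n) : 1 <= x i < l%:Z ->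
  q * (Hdual tau s (shift_coord x i 1) - Hdual tau s x) =
  (p - q) * occ s (x i) * Hdual tau s x.
Proof.
move=> xb; rewrite shift_Hdual (Hdual_split s x i).
have [|b [-> ->]] := @Qheight_succ s (x i); first by move: xb; lia.
have -> : p - q = q * (tau^-1 - 1) by rewrite tau_down.
by case: b; rewrite /= ?expr1z ?expr0z; [field|ring].
Qed.

(** A left jump of [x i] contributes [- b i], a right jump [a i]. The boundary terms at 1 and [l]
    supply the same values, because [occ] is the reservoir density at 0 and [l]. Only the jumps
    blocked by a neighbour are missing, and these cancel in pairs. *)
Lemma Dop_Hdual s x : weyl n l x ->
  Dop l p q rho0 rhol (Hdual tau s) x =
  (p - q) * (\sum_(i < n) (occ s (x i) - occ s (x i - 1))) * Hdual tau s x.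
Proof.
move=> wx; have [xb xm] := wx; rewrite /Dop.
pose a i : R := (p - q) * occ s (x i) * Hdual tau s x.
pose b i : R := (p - q) * occ s (x i - 1) * Hdual tau s x.
have -> : (p - q) * (\sum_(i < n) (occ s (x i) - occ s (x i - 1))) * Hdual tau s x =
    \sum_i a i - \sum_i b i.
  by rewrite -sumrB mulr_sumr mulr_suml; apply: eq_bigr => i _; rewrite /a /b; ring.
under eq_bigr => i _.
  under eq_bigr => j /andP[_ ij].
    rewrite Hdual_left; last by have := xb i; have := xb j; move: ij; lia.
    rewrite -/(b i); over.
  over.
under [X in _ + X + _ + _]eq_bigr => i _.
  under eq_bigr => j /andP[_ ij].
    rewrite Hdual_right; last by have := xb i; have := xb j; move: ij; lia.
    rewrite -/(a i); over.
  over.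
under [X in _ + _ + X + _]eq_bigr => i _.
  have -> : (1 < x i)%R%:R * (p * (Hdual tau s (shift_coord x i (-1)) - Hdual tau s x)) -
     (x i == 1)%:R * ((p - q) * rho0 * Hdual tau s x) = - b i.
    have := xb i; case: (ltP 1 (x i)) => xi1 /andP[x1 xl].
      rewrite Hdual_left ?xi1 // gt_eqF // mul1r mul0r subr0 //.
    have xi : x i = 1 by move: xi1 x1; lia.
    by rewrite mul0r sub0r xi eqxx mul1r /b xi subrr /occ lexx.
  over.
under [X in _ + _ + _ + X]eq_bigr => i _.
  have -> : (x i < l%:Z)%R%:R * (q * (Hdual tau s (shift_coord x i 1) - Hdual tau s x)) +
     (x i == l%:Z)%:R * ((p - q) * rhol * Hdual tau s x) = a i.
    have := xb i; case: (ltP (x i) l%:Z) => xi1 /andP[x1 xl].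
      by rewrite Hdual_right ?x1 // lt_eqF // mul1r mul0r addr0.
    have xi : x i = l%:Z by move: xi1 xl; lia.
    rewrite mul0r add0r xi eqxx mul1r /a xi /occ lexx ifF //.
    by apply/negbTE; move: hl; lia.
  over.
have splitb : \sum_i b i = \sum_(i < n) \sum_(j < n | i == j.+1 :> nat) b i +
    \sum_(i < n | i == 0%N :> nat) b i.
  rewrite (bigID (fun i : 'I_n => i == 0%N :> nat)) /= addrC; congr (_ + _).
  rewrite big_mkcond; apply: eq_bigr => i _; case: ifPn => i0; last first.
    rewrite big_pred0 // => j; apply/negbTE; move: i0; lia.
  have il : (i.-1 < n)%N by have := ltn_ord i; lia.
  by rewrite (big_pred1 (Ordinal il)) // => j; rewrite /= -val_eqE /=; move: i0; lia.
have splita : \sum_i a i = \sum_(i < n) \sum_(j < n | j == i.+1 :> nat) a i +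
    \sum_(i < n | i.+1 == n :> nat) a i.
  rewrite (bigID (fun i : 'I_n => i.+1 == n :> nat)) /= addrC; congr (_ + _).
  rewrite big_mkcond; apply: eq_bigr => i _; case: ifPn => i0; last first.
    by rewrite big_pred0 // => j; apply/negbTE; have := ltn_ord j; move: i0; lia.
  have il : (i.+1 < n)%N by have := ltn_ord i; move: i0; lia.
  by rewrite (big_pred1 (Ordinal il)) // => j; rewrite /= -val_eqE.
have gapb : \sum_(i < n) \sum_(j < n | i == j.+1 :> nat) b i =
   \sum_(i < n) \sum_(j < n | (i == j.+1 :> nat) && (1 < x i - x j)) b i +
   \sum_(i < n) \sum_(j < n | (i == j.+1 :> nat) && ~~ (1 < x i - x j)) b i.
  by rewrite -big_split; apply: eq_bigr => i _; rewrite (bigID (fun j => 1 < x i - x j)).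
have gapa : \sum_(i < n) \sum_(j < n | j == i.+1 :> nat) a i =
   \sum_(i < n) \sum_(j < n | (j == i.+1 :> nat) && (1 < x j - x i)) a i +
   \sum_(i < n) \sum_(j < n | (j == i.+1 :> nat) && ~~ (1 < x j - x i)) a i.
  by rewrite -big_split; apply: eq_bigr => i _; rewrite (bigID (fun j => 1 < x j - x i)).
(* For an adjacent pair x_j = x_i + 1 the suppressed left jump of j and right
   jump of i would contribute opposite amounts. *)
have cancel_adjacent :
   \sum_(i < n) \sum_(j < n | (i == j.+1 :> nat) && ~~ (1 < x i - x j)) b i =
   \sum_(i < n) \sum_(j < n | (j == i.+1 :> nat) && ~~ (1 < x j - x i)) a i.
  rewrite (exchange_big_dep xpredT) //=; apply: eq_bigr => i _.
  apply: eq_bigr => j /andP[/eqP ji xij]; rewrite /a /b.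
  have := xm i j; rewrite ji ltnSn => /(_ isT) xx.
  by have -> : x j - 1 = x i by [move: xx xij; lia].
rewrite splita splitb gapa gapb cancel_adjacent.
under [X in X + _ + _ + _ = _]eq_bigr do rewrite sumrN.
rewrite !sumrN; ring.
Qed.

Lemma open_asep_duality s x : weyl n l x ->
  open_asep_generator p q alpha beta gamma delta (fun s' => Hdual tau s' x) s =
  Dop l p q rho0 rhol (Hdual tau s) x.
Proof. by move=> wx; rewrite generator_Hdual // Dop_Hdual. Qed.

End duality.

(** * Backward equation for transition functions *)

Section esum_EFin.
Context {R : realType} {S : choiceType}.
Implicit Types (a : S -> R).

Lemma esum_EFin_le a M : (forall r, uniq r -> \sum_(z <- r) a z <= M) ->
  (\esum_(z in [set: S]) (a z)%:E <= M%:E)%E.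
Proof.
move=> aM; apply: ge_ereal_sup => _ /= [X [finX _] <-].
by rewrite fsbig_finite // sumEFin lee_fin aM // fset_uniq.
Qed.

Lemma esum_EFin_ge a r : uniq r ->
  ((\sum_(z <- r) a z)%:E <= \esum_(z in [set: S]) (a z)%:E)%E.
Proof.
move=> ur; apply: esum_ge; exists [set` r]; first by split.
by rewrite -fsbig_seq // sumEFin.
Qed.

Lemma esum_EFinZ (c : R) a : 0 <= c ->
  (\esum_(z in [set: S]) (c * a z)%:E = c%:E * \esum_(z in [set: S]) (a z)%:E)%E.
Proof.
move=> c0; rewrite /esum -ereal_supZl //; last first.
  by apply/set0P; exists (\sum_(i \in set0) (a i)%:E)%E, set0 => //; exact: fsets_set0.
rewrite image_comp; congr (ereal_sup _); apply: eq_imagel => X [finX _].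
by rewrite /= !fsbig_finite // !sumEFin -EFinM mulr_sumr.
Qed.

End esum_EFin.

Lemma esum_exchange (R : realType) (S T : choiceType) (a : S -> T -> \bar R) :
  (forall i j, 0 <= a i j)%E ->
  (\esum_(i in [set: S]) \esum_(j in [set: T]) a i j =
   \esum_(j in [set: T]) \esum_(i in [set: S]) a i j)%E.
Proof.
move=> a0; rewrite (@esum_esum _ _ _ _ (fun=> setT)) //.
rewrite (@esum_esum _ _ _ _ (fun=> setT)) //.
rewrite (reindex_esum ([set: T] `*`` (fun=> [set: S])) _ (fun x => (x.2, x.1))) //.
split => //=.
- by move=> [i1 i2] [j1 j2] /= _ _ [] -> ->.
- by move=> [i1 i2] _ /=; exists (i2, i1).
Qed.

(** [fine] sends an infinite sum to 0; [transition_opE] shows that the sum is finite when [f] is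
    nonnegative and bounded. *)
Definition transition_op (R : realType) (S : choiceType) (pt : R -> S -> S -> R)
    (f : S -> R) (t : R) (s : S) : R :=
  fine (\esum_(z in [set: S]) (pt t s z * f z)%:E).

Section transition.
Context {R : realType} {S : choiceType} (W : S -> R) (C : R)
  (L : (S -> R) -> S -> R) (pt : R -> S -> S -> R).
Hypothesis LC : finitary_op setT W C L.
Hypothesis L1 : forall s, L (fun=> 1) s = 0.
Hypothesis ptL : is_transition_function L pt.

Lemma transition_seq_le1 t s r : 0 <= t -> uniq r -> \sum_(z <- r) pt t s z <= 1.
Proof.
by move=> t0 ur; rewrite -lee_fin -(transition_sum1 ptL s t0) esum_EFin_ge.
Qed.

Section bounded.
Variables (f : S -> R) (B : R).
Hypothesis f0 : forall s, 0 <= f s.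
Hypothesis fB : forall s, f s <= B.

(** The mass outside [r] is at most [1 - \sum_(z <- r) pt t s z], and [f] is at most [B] there. With
    the obvious lower bound this encloses the infinite sum between two finite expressions, so limits
    in time are taken on finite sums only. *)
Lemma transition_seq_sub t s r r' : 0 <= t -> uniq r -> uniq r' ->
  \sum_(z <- r') pt t s z * f z <=
  \sum_(z <- r) pt t s z * f z + B * (1 - \sum_(z <- r) pt t s z).
Proof.
move=> t0 ur ur'.
pose r2 := [seq z <- r' | z \notin r].
have ur2 : uniq (r ++ r2).
  rewrite cat_uniq ur filter_uniq // andbT.
  by apply/hasPn => z; rewrite mem_filter => /andP[].
have le2 : \sum_(z <- r') pt t s z * f z <= \sum_(z <- r ++ r2) pt t s z * f z.
  rewrite (bigID (mem r)) /= big_cat /= big_filter lerD2r -big_filter.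
  rewrite [leRHS](bigID (mem r')) /= -[leLHS]addr0 lerD //.
    rewrite -[in leRHS]big_filter; rewrite le_eqVlt; apply/orP; left; apply/eqP/perm_big/uniq_perm.
    - exact: filter_uniq.
    - exact: filter_uniq.
    - by move=> z; rewrite !mem_filter andbC.
  by apply: sumr_ge0 => z _; rewrite mulr_ge0 // (transition_ge0 ptL).
apply: le_trans le2 _; rewrite big_cat /= lerD2l.
have := transition_seq_le1 s t0 ur2; rewrite big_cat /= => le1.
apply: (@le_trans _ _ (\sum_(z <- r2) pt t s z * B)).
  by apply: ler_sum => z _; rewrite ler_wpM2l // (transition_ge0 ptL).
rewrite -mulr_suml mulrC ler_wpM2l //; last by lra.
exact: le_trans (f0 s) (fB s).
Qed.

Lemma transition_esum_le t s r : 0 <= t -> uniq r ->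
  (\esum_(z in [set: S]) (pt t s z * f z)%:E <=
   (\sum_(z <- r) pt t s z * f z + B * (1 - \sum_(z <- r) pt t s z))%:E)%E.
Proof. by move=> t0 ur; apply: esum_EFin_le => r'; exact: transition_seq_sub. Qed.

Lemma transition_opE t s : 0 <= t ->
  ((transition_op pt f t s)%:E = \esum_(z in [set: S]) (pt t s z * f z)%:E)%E.
Proof.
move=> t0; apply: fineK; rewrite ge0_fin_numE.
  by apply: le_lt_trans (transition_esum_le s t0 (isT : uniq [::])) _; rewrite ltry.
by apply: esum_ge0 => z _; rewrite lee_fin mulr_ge0 // (transition_ge0 ptL).
Qed.

Lemma transition_op_le t s r : 0 <= t -> uniq r ->
  transition_op pt f t s <=
  \sum_(z <- r) pt t s z * f z + B * (1 - \sum_(z <- r) pt t s z).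
Proof. by move=> t0 ur; rewrite -lee_fin transition_opE // transition_esum_le. Qed.

Lemma transition_op_ge t s r : 0 <= t -> uniq r ->
  \sum_(z <- r) pt t s z * f z <= transition_op pt f t s.
Proof.
by move=> t0 ur; rewrite -lee_fin transition_opE // esum_EFin_ge.
Qed.

Lemma transition_op_ge0 t s : 0 <= t -> 0 <= transition_op pt f t s.
Proof. by move=> t0; have := transition_op_ge s t0 (isT : uniq [::]); rewrite big_nil. Qed.

Lemma transition_op_leB t s : 0 <= t -> transition_op pt f t s <= B.
Proof.
move=> t0; have := transition_op_le s t0 (isT : uniq [::]).
by rewrite !big_nil add0r subr0 mulr1.
Qed.

Lemma transition_op0 s : transition_op pt f 0 s = f s.
Proof.
have u1 : uniq [:: s] by [].
have := transition_op_le s (lexx 0) u1; have := transition_op_ge s (lexx 0) u1.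
rewrite !big_seq1 (transition_init ptL) eqxx mul1r subrr mulr0 addr0 => h1 h2.
by apply/le_anti; rewrite h1 h2.
Qed.

End bounded.

Lemma transition_op_semigroup f B h t s : (forall s, 0 <= f s) -> (forall s, f s <= B) ->
  0 <= h -> 0 <= t ->
  transition_op pt f (h + t) s = transition_op pt (transition_op pt f t) h s.
Proof.
move=> f0 fB h0 t0; apply: EFin_inj.
have g0 z : 0 <= transition_op pt f t z by exact: transition_op_ge0 f0 fB _ _ t0.
have gB z : transition_op pt f t z <= B by exact: transition_op_leB f0 fB _ _ t0.
rewrite (transition_opE f0 fB) ?addr_ge0 // (transition_opE g0 gB) //.
have p0 := transition_ge0 ptL.
transitivity (\esum_(z' in [set: S]) \esum_(z in [set: S]) (f z' * (pt h s z * pt t z z'))%:E)%E.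
  apply: eq_esum => z' _; rewrite esum_EFinZ // -(transition_semigroup ptL) //.
  by rewrite -EFinM mulrC.
rewrite esum_exchange; last by move=> z' z; rewrite lee_fin !mulr_ge0 // p0.
apply: eq_esum => z _.
rewrite EFinM (transition_opE f0 fB) // -esum_EFinZ ?p0 //.
by apply: eq_esum => z' _; congr (_%:E); ring.
Qed.

(** [transition_rates] concerns [L] on indicators only; finite rows recover [L f] from them. Having
    [s] in [r] makes [r] carry all the mass at time 0. *)
Lemma finitary_indic s : exists2 r, uniq r & s \in r /\
  forall f, L f s = \sum_(z <- r) L (fun z' => (z' == z)%:R) s * f z.
Proof.
have [r0 [_ _ rE]] := LC (I : setT s).
pose r := undup (s :: [seq c.2 | c <- r0]).
exists r; first exact: undup_uniq.
split=> [|f]; first by rewrite mem_undup mem_head.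
rewrite rE big_seq; under [RHS]eq_bigr do rewrite rE mulr_suml.
rewrite exchange_big /= [RHS]big_seq; apply: eq_bigr => c cr.
have c2r : c.2 \in r by rewrite mem_undup inE map_f ?orbT.
rewrite (bigD1_seq c.2) ?undup_uniq //= eqxx mulr1 big1 ?addr0 // => z zc.
by rewrite eq_sym (negbTE zc) mulr0 mul0r.
Qed.

(** By the semigroup property the increment over [[t, t + h]] is that of [g] over [[0, h]]. It is
    squeezed between the finite sum over [r] and that sum plus [B] times the mass that has left
    [r]. *)
Lemma transition_right_derivative f B t s :
  (forall s, 0 <= f s) -> (forall s, f s <= B) -> 0 <= t ->
  right_derivative (transition_op pt f ^~ s) t (L (transition_op pt f t) s).
Proof.
move=> f0 fB t0.
pose g := transition_op pt f t.
have g0 z : 0 <= g z by exact: transition_op_ge0 f0 fB _ _ t0.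
have gB z : g z <= B by exact: transition_op_leB f0 fB _ _ t0.
have [r ur [sr Lr]] := finitary_indic s.
pose d z h := (pt h s z - pt 0 s z) / h.
have cvd z : d z h @[h --> 0^'+] --> L (fun z' => (z' == z)%:R) s.
  exact: (transition_rates ptL).
have init (phi : S -> R) : \sum_(z <- r) pt 0 s z * phi z = phi s.
  rewrite (bigD1_seq s) //= (transition_init ptL) eqxx mul1r big1 ?addr0 // => z zs.
  by rewrite (transition_init ptL) eq_sym (negbTE zs) mul0r.
have low : \sum_(z <- r) d z h * g z @[h --> 0^'+] --> L g s.
  rewrite Lr; apply: cvg_bigsum => z _; apply: cvgM => //; exact: cvg_cst.
(* The mass leaving [r] is o(h): the rates of row [s] all sit in [r] and add up to [L 1 = 0]. *)
have mass : \sum_(z <- r) d z h @[h --> 0^'+] --> (0 : R).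
  rewrite -[X in _ --> X](L1 s) Lr; apply: cvg_bigsum => z _; rewrite mulr1.
  exact: cvd.
have high : \sum_(z <- r) d z h * g z - B * \sum_(z <- r) d z h @[h --> 0^'+] --> L g s.
  rewrite -[X in _ --> X]subr0 -[X in _ --> _ - X](mulr0 B).
  by apply: cvgB => //; apply: cvgM => //; exact: cvg_cst.
apply: squeeze_cvgr low high; near=> h.
have h0 : 0 < h by near: h; exact: nbhs_right_gt.
have dE (phi : S -> R) : \sum_(z <- r) d z h * phi z =
    (\sum_(z <- r) pt h s z * phi z - phi s) / h.
  rewrite -[in RHS](init phi) -sumrB mulr_suml; apply: eq_bigr => z _.
  by rewrite /d; ring.
rewrite [t + h]addrC (transition_op_semigroup _ f0 fB) ?(ltW h0) // -/g.
have dE1 : \sum_(z <- r) d z h = (\sum_(z <- r) pt h s z - 1) / h.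
  have := dE (fun=> 1); under eq_bigr do rewrite mulr1.
  by under [in X in _ = X]eq_bigr do rewrite mulr1.
rewrite dE dE1; apply/andP; split.
  rewrite ler_wpM2r ?invr_ge0 ?(ltW h0) // lerB //.
  by apply: (transition_op_ge g0 gB) => //; exact: ltW.
rewrite mulrA -mulrBl ler_wpM2r ?invr_ge0 ?(ltW h0) //.
by have := transition_op_le g0 gB s (ltW h0) ur; rewrite -/g; lra.
Unshelve. all: by end_near. Qed.

(** Conditioning on the first [h] units of time, the values at [t] and [t - h] differ by at most
    [B * (1 - pt h s s)], whatever the function reached at [t - h]. *)
Lemma transition_left_continuous f B t s :
  (forall s, 0 <= f s) -> (forall s, f s <= B) -> 0 < t ->
  left_continuous (transition_op pt f ^~ s) t.
Proof.
move=> f0 fB t0; rewrite /left_continuous.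
have B0 : 0 <= B by exact: le_trans (f0 s) (fB s).
have cvp : B * (1 - pt h s s) @[h --> 0^'+] --> (0 : R).
  (* The diagonal rate exists, so [1 - pt h s s] is a convergent quotient times [h]. *)
  have : B * - ((pt h s s - pt 0 s s) / h * h) @[h --> 0^'+] -->
      B * - (L (fun z' => (z' == s)%:R) s * 0).
    apply: cvgM; first exact: cvg_cst.
    apply: cvgN; apply: cvgM; first exact: (transition_rates ptL).
    by apply: cvg_at_right_filter; exact: cvg_id.
  rewrite mulr0 oppr0 mulr0; apply: cvg_trans; apply: near_eq_cvg.
  near=> h; have h0 : h != 0 by rewrite gt_eqF //; near: h; exact: nbhs_right_gt.
  by rewrite divfK // (transition_init ptL) eqxx opprB.
apply/cvgrPdist_le => e e0.
near=> h.
have h0 : 0 < h by near: h; exact: nbhs_right_gt.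
have ht : h < t by near: h; exact: nbhs_right_lt.
have small : B * (1 - pt h s s) <= e.
  by near: h; exact: (cvgr_le _ cvp).
have th0 : 0 <= t - h by rewrite subr_ge0 ltW.
pose g := transition_op pt f (t - h).
have g0 z : 0 <= g z by exact: transition_op_ge0 f0 fB _ _ th0.
have gB z : g z <= B by exact: transition_op_leB f0 fB _ _ th0.
have -> : transition_op pt f t s = transition_op pt g h s.
  by rewrite -(transition_op_semigroup _ f0 fB) ?(ltW h0) // addrC subrK.
have u1 : uniq [:: s] by [].
have := transition_op_le g0 gB s (ltW h0) u1; have := transition_op_ge g0 gB s (ltW h0) u1.
rewrite !big_seq1 => lo hi.
have := transition_seq_le1 s (ltW h0) u1; rewrite big_seq1 => p1.
have : (1 - pt h s s) * g s <= (1 - pt h s s) * B by rewrite ler_wpM2l // subr_ge0.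
have : 0 <= (1 - pt h s s) * g s by rewrite mulr_ge0 // subr_ge0.
rewrite ler_norml -/g; move: lo hi small; set x := transition_op pt g h s.
by move=> *; apply/andP; split; lra.
Unshelve. all: by end_near. Qed.

End transition.

(** * Expectations and weights *)

(** The fibres of [Y] cut [Omega] into countably many measurable pieces on which the integrand is
    constant. *)
Lemma expectation_esum (R : realType) (S : countType) (d : measure_display)
    (Omega : measurableType d) (P : probability Omega R) (Y : Omega -> S)
    (f pi : S -> R) :
  (forall s, measurable (Y @^-1` [set s])) ->
  (forall s, P (Y @^-1` [set s]) = (pi s)%:E) ->
  (forall s, 0 <= f s) ->
  ('E_P[fun w => f (Y w)] = \esum_(s in [set: S]) (pi s * f s)%:E)%E.
Proof.
move=> mY Ppi f0; rewrite unlock.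
(* Fibres numbered by the codes of the states; a code that belongs to no state gets the empty
   set. *)
pose F (k : nat) := if @pickle_inv S k is Some s then Y @^-1` [set s] else set0.
have F_pickle w : F (pickle (Y w)) w by rewrite /F pickleK_inv.
have FE k w : F k w -> k = pickle (Y w).
  rewrite /F; case E: (pickle_inv k) => [s|//] /= ->.
  by have := @pickle_invK S k; rewrite E.
have mF k : measurable (F k) by rewrite /F; case: pickle_inv.
have FT : \bigcup_k F k = setT.
  by rewrite -subTset => w _; exists (pickle (Y w)).
have tF : trivIset setT F.
  by move=> i j _ _ [w [/FE -> /FE ->]].
pose g (k : nat) : R := if @pickle_inv S k is Some s then f s else 0.
have gE k w : F k w -> f (Y w) = g k by move=> /FE ->; rewrite /g pickleK_inv.
have mf : measurable_fun (\bigcup_k F k) (EFin \o (f \o Y)).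
  apply/measurable_fun_bigcup => // k.
  apply: (eq_measurable_fun (cst (g k)%:E)) => [w|]; last exact: measurable_cst.
  by rewrite inE => /gE <-.
rewrite -FT ge0_integral_bigcup // => [|w _]; last by rewrite lee_fin.
pose a (k : nat) : \bar R := (if @pickle_inv S k is Some s then (pi s * f s)%:E else 0)%E.
have pi0 s : 0 <= pi s by rewrite -lee_fin -Ppi.
have a0 k : (0 <= a k)%E.
  by rewrite /a; case: pickle_inv => // s; rewrite lee_fin mulr_ge0.
transitivity (\sum_(k <oo) a k)%E.
  apply: eq_eseriesr => k _.
  under eq_integral => w.
    rewrite inE => /gE ->.
    over.
  rewrite integral_cst // /g /F /a; case: pickle_inv => [s|].
    by transitivity ((f s)%:E * (pi s)%:E)%E; [congr (_ * _)%E; exact: Ppi|rewrite -EFinM mulrC].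
  by rewrite measure0 mule0.
rewrite nneseries_esumT //.
transitivity (\esum_(k in pickle @` [set: S]) a k)%E.
  rewrite [RHS]esum_mkcond; apply: eq_esum => k _.
  case: ifPn => // /negP; rewrite inE /= => kS.
  rewrite /a; case E: (pickle_inv k) => [s|//]; exfalso; apply: kS.
  by exists s => //; have := @pickle_invK S k; rewrite E.
rewrite esum_image; last by apply: in2W; exact: pcan_inj pickleK.
by apply: eq_esum => s _; rewrite /a pickleK_inv.
Qed.

Lemma markov_process_law (R : realType) (S : choiceType) (L : (S -> R) -> S -> R)
    (s0 : S) (d : measure_display) (Omega : measurableType d)
    (P : probability Omega R) (X : R -> Omega -> S) :
  is_markov_jump_process L s0 P X ->
  exists2 pt, is_transition_function L pt &
    forall t s, 0 <= t -> P (X t @^-1` [set s]) = (pt t s0 s)%:E.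
Proof.
move=> XP; have [pt ptL markov] := process_markov XP; exists pt => // t s t0.
have mX := process_measurable XP.
have := markov [::] 0 t s0 s (lexx 0) t0.
have -> : [set w | forall c : R * S, c \in [::] -> X c.1 w = c.2] = setT.
  by rewrite -subTset => w _ c.
rewrite /= !setTI add0r (process_init XP) mul1e => <- //.
have m0 : measurable (X 0 @^-1` [set s0]) by apply: mX.
have mt : measurable (X t @^-1` [set s]) by apply: mX.
rewrite setIC; apply/esym.
have null : P (~` (X 0 @^-1` [set s0])) = 0%E.
  by rewrite probability_setC // (process_init XP) subee.
rewrite -[in RHS](setIT (X t @^-1` [set s])) -(setUv (X 0 @^-1` [set s0])) setIUr.
apply/esym; rewrite measureU0 //; first exact: measurableI.
  by apply: measurableI => //; exact: measurableC.
apply/eqP; rewrite eq_le measure_ge0 andbT -null le_measure ?inE //.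
- by apply: measurableI => //; exact: measurableC.
- exact: measurableC.
Qed.

Lemma exprz_anti (R : realType) (x : R) (m k : int) : 0 < x -> x <= 1 -> m <= k ->
  x ^ k <= x ^ m.
Proof.
move=> x0 x1 mk; rewrite -[k](subrK m) expfzDr ?gt_eqF // ler_piMl ?exprz_ge0 ?(ltW x0) //.
have : 0 <= k - m by rewrite subr_ge0.
by case: (k - m) => // j _; rewrite -exprnP exprn_ile1 // ltW.
Qed.

Section open_asep_weight.
Context {R : realType} (l n : nat) (tau : R).
Hypothesis tau0 : 0 < tau.
Hypothesis tau1 : tau < 1.
Implicit Types s : state l.

(* Grows strictly faster than the duality function as N tends to -oo. *)
Definition height_weight s : R := 1 + (tau ^ s.2) ^+ n.+1.

Let tauz (k : int) : 0 < tau ^ k. Proof. exact: exprz_gt0. Qed.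

Lemma height_weight_ge1 s : 1 <= height_weight s.
Proof. by rewrite lerDl exprn_ge0 // ltW. Qed.

Lemma height_weight_shift s eta (k : int) : -1 <= k <= 1 ->
  height_weight (eta, s.2 + k) <= (tau^-1) ^+ n.+1 * height_weight s.
Proof.
move=> /andP[k1 _]; rewrite /height_weight /= mulrDr mulr1 lerD //.
  by rewrite exprn_ege1 // invf_ge1 // ltW.
rewrite -exprMn lerXn2r ?nnegrE ?mulr_ge0 ?invr_ge0 ?(ltW tau0) ?(ltW (tauz _)) //.
rewrite expfzDr ?gt_eqF // mulrC ler_wpM2r ?(ltW (tauz _)) //.
by rewrite -exprN1 exprz_anti // ltW.
Qed.

Lemma Nheight_ge s z : s.2 <= Nheight s z.
Proof. by rewrite /Nheight lerDr sumr_ge0. Qed.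

Lemma Hdual_ge0 s (x : {ffun 'I_n -> int}) : 0 <= Hdual tau s x.
Proof. by apply: prodr_ge0 => i _; rewrite ltW // tauz. Qed.

Lemma Hdual_le s (x : {ffun 'I_n -> int}) : Hdual tau s x <= (tau ^ s.2) ^+ n.
Proof.
rewrite /Hdual -[X in _ ^+ X]card_ord -prodr_const; apply: ler_prod => i _.
by rewrite (ltW (tauz _)) /= exprz_anti ?Nheight_ge // ltW.
Qed.

(** The summand 1 of the weight covers [tau ^ s.2 <= 1]; otherwise the power [n.+1] dominates the
    power [n]. *)
Lemma Hdual_le_weight s (x : {ffun 'I_n -> int}) : Hdual tau s x <= height_weight s.
Proof.
apply: le_trans (Hdual_le _ _) _; rewrite /height_weight.
have t0 := ltW (tauz s.2); have [t1|t1] := leP (tau ^ s.2) 1.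
  by apply: le_trans (exprn_ile1 _ t0 t1) _; rewrite lerDl exprn_ge0.
by apply: le_trans (_ : _ <= (tau ^ s.2) ^+ n.+1) _; rewrite ?lerDr // ler_eXn2l.
Qed.

Definition Hdual_trunc (M : nat) (x : {ffun 'I_n -> int}) s : R :=
  if - M%:Z <= s.2 then Hdual tau s x else 0.

Lemma Hdual_trunc_ge0 M x s : 0 <= Hdual_trunc M x s.
Proof. by rewrite /Hdual_trunc; case: ifP => // _; exact: Hdual_ge0. Qed.

Lemma Hdual_trunc_le M x s : Hdual_trunc M x s <= (tau ^ (- M%:Z)) ^+ n.
Proof.
rewrite /Hdual_trunc; case: ifP => [Ms|_]; last by rewrite exprn_ge0 // ltW.
apply: le_trans (Hdual_le _ _) _.
by rewrite lerXn2r ?nnegrE ?(ltW (tauz _)) // exprz_anti // ltW.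
Qed.

Lemma Hdual_trunc_leH M x s : Hdual_trunc M x s <= Hdual tau s x.
Proof. by rewrite /Hdual_trunc; case: ifP => // _; exact: Hdual_ge0. Qed.

(** Where N < - M, the spare factor [tau ^ N] of the weight exceeds [tau ^ (- M)], which pays for
    [tau ^+ M]. *)
Lemma Hdual_trunc_error M x s :
  `|Hdual tau s x - Hdual_trunc M x s| <= tau ^+ M * height_weight s.
Proof.
have W0 : 0 <= height_weight s by exact: le_trans (height_weight_ge1 s).
rewrite /Hdual_trunc; case: ifPn => [_|]; last rewrite -ltNge => Ms.
  by rewrite subrr normr0 mulr_ge0 // exprn_ge0 // ltW.
rewrite subr0 ger0_norm ?Hdual_ge0 //; apply: le_trans (Hdual_le _ _) _.
have M0 : 0 <= tau ^+ M by rewrite exprn_ge0 // ltW.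
apply: (@le_trans _ _ (tau ^+ M * (tau ^ s.2) ^+ n.+1)); last first.
  by rewrite ler_wpM2l // /height_weight lerDr.
rewrite exprS mulrA ler_peMl //; first by rewrite exprn_ge0 // ltW.
rewrite exprnP -expfzDr ?gt_eqF // -(expr0z tau) exprz_anti // ?(ltW tau1) //.
by move: Ms; lia.
Qed.

End open_asep_weight.

(** * Uniqueness and the expectation formula *)

Lemma has_derivative_Rplus_bounded (R : realType) (phi : R -> R) (T : R) : 0 <= T ->
  (forall t, 0 <= t -> exists a, has_derivative_Rplus phi t a) ->
  exists K, forall t, 0 <= t <= T -> `|phi t| <= K.
Proof.
move=> T0 dphi.
have cphi : {within `[0, T], continuous phi}.
  apply/subspace_continuousP => t; rewrite /= in_itv /= => /andP[t0 _].
  have [a /has_derivative_Rplus_continuous] := dphi t t0.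
  apply: cvg_trans; apply: cvg_app; apply: within_subset => r /=.
  by rewrite in_itv /= => /andP[].
have [c1 _ h1] := EVT_max T0 cphi; have [c2 _ h2] := EVT_min T0 cphi.
exists (`|phi c1| + `|phi c2|) => t tT.
have {}tT : t \in `[0, T] by rewrite in_itv.
have := h1 t tT; have := h2 t tT.
have := ler_norm (phi c1); have := ler_norm (- phi c2); rewrite normrN.
have := normr_ge0 (phi c1); have := normr_ge0 (phi c2).
by move=> *; rewrite ler_norml; apply/andP; split; lra.
Qed.

(** The chamber is finite: its points are coded by functions into ['I_l.+1], and the sum of the
    bounds over all codes dominates each of them. Codes outside the chamber get the bound 0. *)
Lemma weyl_uniform_bound (R : realType) (n l : nat) (I : Type) (D : set I)
    (w : I -> {ffun 'I_n -> int} -> R) :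
  (forall x, weyl n l x -> exists K, forall t, D t -> `|w t x| <= K) ->
  exists2 K, 0 <= K & forall t x, weyl n l x -> D t -> `|w t x| <= K.
Proof.
move=> wK.
pose e (y : {ffun 'I_n -> 'I_l.+1}) : {ffun 'I_n -> int} := [ffun i => (y i : nat)%:Z].
have /choice[K hK] y : exists K, weyl n l (e y) -> forall t, D t -> `|w t (e y)| <= K.
  by have [/wK[K hK]|] := pselect (weyl n l (e y)); [exists K|exists 0].
exists (\sum_y `|K y|) => [|t x wx Dt]; first exact: sumr_ge0.
have [xb _] := wx.
have xe : x = e [ffun i => inord `|x i|%N].
  apply/ffunP => i; have xi := xb i; rewrite !ffunE inordK; last by move: xi; lia.
  by case: (x i) xi.
rewrite xe in wx *; apply: le_trans (hK _ wx t Dt) _.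
by rewrite (bigD1 [ffun i => inord `|x i|%N]) //= ler_wpDr ?ler_norm // sumr_ge0.
Qed.

Section dual_system.
Context {R : realType} (l n : nat) (p q rho0 rhol : R) (s0 : state l).

Lemma solves_dual_system_uniq (u v : R -> {ffun 'I_n -> int} -> R) :
  solves_dual_system p q rho0 rhol s0 u -> solves_dual_system p q rho0 rhol s0 v ->
  forall t x, 0 <= t -> weyl n l x -> v t x = u t x.
Proof.
move=> [du u0] [dv v0] T y T0 wy.
have [C C0 DC] := @Dop_finitary R l p q n rho0 rhol.
pose w t x := v t x - u t x.
have [K K0 wK] : exists2 K, 0 <= K &
    forall t x, weyl n l x -> 0 <= t <= T -> `|w t x| <= K.
  apply: (@weyl_uniform_bound _ _ _ _ [set t | 0 <= t <= T]) => x wx.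
  have [Ku hu] : exists K, forall t, 0 <= t <= T -> `|u t x| <= K.
    by apply: has_derivative_Rplus_bounded => // t t0; exists (Dop l p q rho0 rhol (u t) x); exact: du.
  have [Kv hv] : exists K, forall t, 0 <= t <= T -> `|v t x| <= K.
    by apply: has_derivative_Rplus_bounded => // t t0; exists (Dop l p q rho0 rhol (v t) x); exact: dv.
  by exists (Kv + Ku) => t tT; apply: le_trans (ler_normB _ _) _; rewrite lerD ?hu ?hv.
have TT : 0 <= T <= T by rewrite T0 lexx.
(* Both solutions start from the same data, so Gronwall applies with [eps = 0]. *)
have : `|w T y| <= 2 * 0 * expR (2 * C * T) * 1.
  apply: (@gronwall_op _ _ _ (fun=> 1) C _ w T K 0 C0 K0 (lexx 0) _ DC) => //.
  - move=> t x wx t0; rewrite (finitary_sub _ _ (DC x wx)).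
    by apply: right_derivativeB; apply: has_derivative_Rplus_right => //; [exact: dv|exact: du].
  - move=> t x wx t0; apply: left_continuousB.
      by apply: has_derivative_Rplus_left_continuous (dv x t wx (ltW t0)).
    by apply: has_derivative_Rplus_left_continuous (du x t wx (ltW t0)).
  - by move=> t x wx tT; rewrite mulr1 wK.
  - by move=> x wx; rewrite /w v0 // u0 // subrr normr0 mul0r.
by rewrite mulr0 !mul0r normr_le0 subr_eq0 => /eqP.
Qed.

End dual_system.

Section open_asep.
Context {R : realType} (l n : nat) (p q alpha beta gamma delta : R).
Hypothesis hl : (2 <= l)%N.
Hypothesis q0 : 0 < q.
Hypothesis qp : q < p.
Hypothesis hag : alpha / p + gamma / q = 1.
Hypothesis hbd : beta / p + delta / q = 1.
Let p0 : 0 < p. Proof. exact: lt_trans qp. Qed.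
Let tau := q / p.
Let tau0 : 0 < tau. Proof. by rewrite divr_gt0. Qed.
Let tau1 : tau < 1. Proof. by rewrite ltr_pdivrMr // mul1r. Qed.
Let rho0 := alpha / p.
Let rhol := delta / q.
Let G := @open_asep_generator R l p q alpha beta gamma delta.
Let Dual := @Dop R n l p q rho0 rhol.
Let W := @height_weight R l n tau.
Implicit Types (s : state l) (x : {ffun 'I_n -> int}).

Let W0 s : 0 <= W s. Proof. exact: le_trans (height_weight_ge1 _ tau0 s). Qed.

Let GC : exists2 C, 0 < C & finitary_op setT W C G.
Proof.
apply: (@open_asep_generator_finitary _ _ _ _ _ _ _ _ _ (tau^-1 ^+ n.+1)).
- by rewrite exprn_ege1 // invf_ge1 // ltW.
- exact: W0.
- by move=> s eta k; exact: height_weight_shift.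
Qed.

(** The operators act on different variables and commute, so D L^j H = L^j D H = L^(j+1) H by
    duality. *)
Lemma iter_generator_Hdual k s x : weyl n l x ->
  iter k Dual (Hdual tau s) x = iter k G (fun s' => Hdual tau s' x) s.
Proof.
have [C _ hG] := GC; have [C' _ hD] := @Dop_finitary R l p q n rho0 rhol.
have step j s' x' : weyl n l x' ->
    Dual (fun y => iter j G (fun s'' => Hdual tau s'' y) s') x' =
    iter j.+1 G (fun s'' => Hdual tau s'' x') s'.
  elim: j s' x' => [|j ih] s' x' wx'; first by apply/esym/open_asep_duality.
  pose g (y : {ffun 'I_n -> int}) s'' := iter j G (fun s3 => Hdual tau s3 y) s''.
  transitivity (G (fun s'' : state l => Dual (g^~ s'') x') s').
    exact: (finitary_comm g (hD x' wx') (hG s' I)).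
  by congr (G _ _); apply/funext => s''; exact: ih.
elim: k x => [//|k ih] x wx.
by rewrite -step //=; apply: finitary_eq (hD x wx) _ => y wy; exact: ih.
Qed.

Lemma exp_op_generator_Hdual t s x : weyl n l x ->
  exp_op Dual (Hdual tau s) t x = exp_op G (fun s' => Hdual tau s' x) t s.
Proof.
move=> wx; rewrite /exp_op; congr (limn (pseries _ _)); apply/funext => k.
by rewrite iter_generator_Hdual.
Qed.

Lemma exp_op_solves_dual_system s :
  solves_dual_system p q rho0 rhol s (exp_op Dual (Hdual tau s)).
Proof.
have [C C0 hD] := @Dop_finitary R l p q n rho0 rhol.
split=> [x t wx t0|x wx]; last exact: exp_op0.
apply: is_derive_has_derivative_Rplus.
(* The state is frozen here, so [W s] serves as the constant bounding the initial data against the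
   weight 1. *)
apply: (@exp_op_deriv _ _ (weyl n l) (fun=> 1) C (W s) _ _ _ _ _ hD _ t x wx) => //.
  exact: ltW.
by move=> y _; rewrite mulr1 ger0_norm ?Hdual_ge0 // Hdual_le_weight.
Qed.

Section expectation.
Variable pt : R -> state l -> state l -> R.
Hypothesis ptG : is_transition_function G pt.

Let HW x s : `|Hdual tau s x| <= 1 * W s.
Proof. by rewrite mul1r ger0_norm ?Hdual_ge0 // Hdual_le_weight. Qed.

Lemma open_asep_generator_cst s : G (fun=> 1) s = 0.
Proof.
rewrite /G /open_asep_generator /= subrr !big1 ?addr0 // => x _.
- by rewrite !mulr0 addr0.
- by rewrite mulr0.
- by rewrite big1 // => y _; rewrite mulr0.
Qed.

(** [K] does not depend on [M]: the bound [B] of the truncation enters Gronwall only as the a priori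
    constant, and the error at time 0 is [tau ^+ M] times the weight. *)
Lemma transition_trunc_error t s x : 0 <= t -> exists K, forall M,
  `|exp_op G (fun s' => Hdual tau s' x) t s -
    transition_op pt (Hdual_trunc tau M x) t s| <= tau ^+ M * K.
Proof.
move=> t0; have [C C0 hG] := GC.
exists (2 * expR (2 * C * t) * W s) => M.
pose f := @Hdual_trunc R l n tau M x; pose B := (tau ^ (- M%:Z)) ^+ n.
have f0 z : 0 <= f z by exact: Hdual_trunc_ge0.
have fB z : f z <= B by exact: Hdual_trunc_le.
have B0 : 0 <= B by exact: le_trans (f0 s) (fB s).
pose F (r : R) (s' : state l) : R := exp_op G (fun z => Hdual tau z x) r s'.
pose w (r : R) (s' : state l) : R := F r s' - transition_op pt f r s'.
have dF r s' : is_derive r (1 : R) (F^~ s') (G (F r) s').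
  by apply: (@exp_op_deriv _ _ setT W C 1) => //; exact: ltW.
have tt : 0 <= t <= t by rewrite t0 lexx.
suff : `|w t s| <= 2 * tau ^+ M * expR (2 * C * t) * W s.
  by congr (_ <= _); ring.
apply: (@gronwall_op _ _ setT W C G w t (expR (C * t) + B)) => //.
- by rewrite addr_ge0 // expR_ge0.
- by rewrite exprn_ge0 // ltW.
- move=> r s' _ r0; rewrite (finitary_sub _ _ (hG s' I)).
  apply: right_derivativeB.
    by apply: has_derivative_Rplus_right => //; exact: is_derive_has_derivative_Rplus.
  exact: (transition_right_derivative hG open_asep_generator_cst ptG f0 fB).
- move=> r s' _ r0; apply: left_continuousB.
    by apply: has_derivative_Rplus_left_continuous (is_derive_has_derivative_Rplus (dF r s')).
  exact: (transition_left_continuous ptG f0 fB).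
- move=> r s' _ /andP[r0 rt]; apply: le_trans (ler_normB _ _) _; rewrite mulrDl lerD //.
    have := @exp_op_bound _ _ setT W C 1 G _ (fun z _ => W0 z) (ltW C0) ler01 hG
      (fun z _ => HW x z) s' r I.
    move=> /le_trans; apply; rewrite mul1r mulrC ler_wpM2r //.
    by rewrite ler_expR ler_wpM2l ?(ltW C0) // ger0_norm.
  rewrite ger0_norm ?(transition_op_ge0 ptG f0 fB) //.
  apply: le_trans (transition_op_leB ptG f0 fB s' r0) _.
  by rewrite ler_peMr // height_weight_ge1.
- by move=> s' _; rewrite /w /F exp_op0 (transition_op0 ptG f0 fB) Hdual_trunc_error.
Qed.

Lemma transition_esum_Hdual t s x : 0 <= t ->
  (\esum_(z in [set: state l]) (pt t s z * Hdual tau z x)%:E =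
   (exp_op G (fun s' => Hdual tau s' x) t s)%:E)%E.
Proof.
move=> t0; have [K hK] := transition_trunc_error s x t0.
set F := exp_op _ _ _ _ in hK *.
have pt0 := transition_ge0 ptG.
have f0 M (z : state l) : 0 <= Hdual_trunc tau M x z by exact: Hdual_trunc_ge0.
have fB M (z : state l) : Hdual_trunc tau M x z <= (tau ^ (- M%:Z)) ^+ n by exact: Hdual_trunc_le.
have small e : 0 < e -> exists M0, forall M, (M0 <= M)%N -> tau ^+ M * K <= e.
  move=> e0.
  have cvK : tau ^+ M * K @[M --> \oo] --> (0 : R).
    rewrite -[X in _ --> X](mul0r K); apply: cvgM; last exact: cvg_cst.
    by apply: cvg_expr; rewrite gtr0_norm.
  have : \forall M \near \oo, tau ^+ M * K <= e by exact: (cvgr_le _ cvK).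
  by case=> M0 _ h; exists M0 => M /h.
apply/le_anti/andP; split.
  apply: esum_EFin_le => r ur; apply/ler_addgt0Pr => e /small[M0 hM0].
  (* Beyond every |N| occurring in [r], so the truncation is invisible on this finite sum, and
     beyond [M0], so the error is at most [e]. *)
  pose M := (M0 + \sum_(z <- r) `|z.2|%N)%N.
  have -> : \sum_(z <- r) pt t s z * Hdual tau z x =
      \sum_(z <- r) pt t s z * Hdual_trunc tau M x z.
    rewrite big_seq [RHS]big_seq; apply: eq_bigr => z zr; congr (_ * _).
    have zM : (`|z.2| <= M)%N by rewrite /M (bigD1_seq z) //= addnCA leq_addr.
    by rewrite /Hdual_trunc ifT //; move: (M) (z.2) zM => m k; lia.
  apply: le_trans (transition_op_ge ptG (f0 M) (fB M) s t0 ur) _.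
  have := hK M; have := hM0 M (leq_addr _ _).
  by rewrite ler_distl => h1 /andP[h2 _]; lra.
apply/lee_addgt0Pr => e /small[M /(_ M (leqnn _)) he].
(* For the other inequality one large [M] suffices, as the truncation lies below [H]. *)
apply: (@le_trans _ _ ((transition_op pt (Hdual_trunc tau M x) t s)%:E + e%:E)%E).
  by rewrite -EFinD lee_fin; have := hK M; rewrite ler_distl => /andP[_ h]; lra.
rewrite leeD2r // (transition_opE ptG (f0 M) (fB M)) //; apply: le_esum => z _.
by rewrite lee_fin ler_wpM2l ?pt0 // Hdual_trunc_leH.
Qed.

End expectation.

End open_asep.

Theorem proposition3p4 (R : realType) (l n : nat)
    (p q alpha beta gamma delta : R)
    (hl : (2 <= l)%N) (hn : (1 <= n)%N) (hq : 0 < q) (hpq : q < p)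
    (halpha : 0 <= alpha) (hbeta : 0 <= beta)
    (hgamma : 0 <= gamma) (hdelta : 0 <= delta)
    (hag : alpha / p + gamma / q = 1) (hbd : beta / p + delta / q = 1)
    (eta : config l) (N : nat) :
  let rho0 := alpha / p in
  let rhol := delta / q in
  let s0 : state l := (eta, N%:Z) in
  exists u : R -> {ffun 'I_n -> int} -> R,
    [/\ solves_dual_system p q rho0 rhol s0 u,
        (forall v : R -> {ffun 'I_n -> int} -> R,
           solves_dual_system p q rho0 rhol s0 v ->
           forall t x, 0 <= t -> weyl n l x -> v t x = u t x) &
        (forall (d : measure_display) (Omega : measurableType d)
                (P : probability Omega R) (X : R -> Omega -> state l),
           is_open_asep p q alpha beta gamma delta s0 P X ->
           forall t x, 0 <= t -> weyl n l x ->
             ('E_P[fun w => Hdual (q / p) (X t w) x] = (u t x)%:E)%E)].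
Proof.
move=> rho0 rhol s0.
have p0 : 0 < p by exact: lt_trans hpq.
exists (exp_op (Dop l p q rho0 rhol) (Hdual (q / p) s0)); split.
- exact: exp_op_solves_dual_system.
- move=> v dv t x t0 wx.
  by apply: solves_dual_system_uniq dv _ _ t0 wx; exact: exp_op_solves_dual_system.
move=> d Omega P X XP t x t0 wx.
have [pt ptG law] := markov_process_law XP.
rewrite (exp_op_generator_Hdual hl hq hpq hag hbd) //.
rewrite -(transition_esum_Hdual hl hq hpq ptG) //.
apply: (@expectation_esum _ _ _ _ _ (X t) (fun s => Hdual (q / p) s x)) => s.
- exact: process_measurable XP _ _ t0.
- exact: law.
- by rewrite Hdual_ge0 // divr_gt0.
Qed.
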